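(* Let $\mathbb{F}_q$ be the finite field with $q$ elements, $d\ge 2$, $t\in\mathbb{F}_q\setminus\{0\}$, $E\subseteq\mathbb{F}_q^d$. Let $n\ge 5$, write $n=2k$ or $n=2k+1$ with $k$ an integer, and let $0<\delta<\frac{1}{2\lfloor n/2\rfloor^2}$. Then for all sufficiently large $q$, $$\left|C_n^{dist}-\frac{|E|^n}{q^n}\right|\le \left(36+80\cdot 6^{\lfloor \frac{n}{2}\rfloor-2}+12\left\lfloor \frac{n}{2}\right\rfloor\right)\frac{|E|^n}{q^n}q^{-\left(\frac{n}{2}-1\right)\delta}$$ whenever $$|E|\ge\begin{cases} q^{\frac12\left(d+2-\frac{k-2}{k-1}+\delta\right)} & n=2k,\\ q^{\frac12\left(d+2-\frac{2k-3}{2k-1}+\delta\right)} & n=2k+1.\end{cases}$$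
   Context: For $x\in\mathbb{F}_q^d$, $\|x\|=x_1^2+\dots+x_d^2$. $C_n^{dist}$ is the number of $n$-tuples $(x_1,\dots,x_n)\in E^n$ with $\|x_i-x_{i+1}\|=t$ for $1\le i\le n-1$ and $\|x_n-x_1\|=t$ (cycles of length $n$ in the graph on $E$ where $x,y$ are adjacent iff $\|x-y\|=t$; vertices not required distinct).
   Formalization: The formal statement assumes q is odd; for large even q the claim fails, since with E = F_q^d in characteristic 2 the count C_n is 0 for odd n and q times |E|^n/q^n for even n. *)

(* Defs.v *)
From HB Require Import structures.
From mathcomp Require Import all_boot all_order all_algebra.
From mathcomp Require Import reals exp.

Set Implicit Arguments.
Unset Strict Implicit.
Unset Printing Implicit Defensive.

Import Order.TTheory GRing.Theory Num.Theory.

Local Open Scope ring_scope.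

Section DistanceGraph.
Variables (F : finFieldType) (d : nat).

Definition sqnorm (x : 'rV[F]_d) : F := \sum_(i < d) x 0 i ^+ 2.

Definition dist_adj (t : F) : rel 'rV[F]_d := [rel x y | sqnorm (x - y) == t].

(* [cycle e c] relates consecutive entries of [c], and the last to the first,
   by [e]; it does not require the entries to be distinct. *)
Definition dist_cycles (t : F) (E : {set 'rV[F]_d}) (n : nat) :
    {set n.-tuple 'rV[F]_d} :=
  [set c : n.-tuple 'rV[F]_d | all [in E] c && cycle (dist_adj t) c].

Definition cycle_count (t : F) (E : {set 'rV[F]_d}) (n : nat) : nat :=
  #|dist_cycles t E n|.

End DistanceGraph.

(* Main.v *)
(* The number of cycles is the trace of [A^n], where [A] is the adjacency matrix of the distance
   graph restricted to [E]. Write [A = (1/q) 1_E 1_E^T + B]. The operator norm of [B] is at most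
   [lam = 2 q^((d-1)/2)], by Plancherel and the bound [2 sqrt q] for the Kloosterman ([d] even) and
   Salié ([d] odd) sums that occur as Fourier coefficients of the sphere. Expanding the trace
   around the rank-one part gives the main term [M^n], [M = |E|/q], up to [O(lam (M + lam)^(n-1))],
   and [|tr B^n| <= lam^(n-2) ||B||_2^2], where [||B||_2^2] is about [|E|^2/q]. The threshold on
   [|E|] is the one for which the last term is [2^(n-2) M^n q^(-(n/2-1) delta)].

   The Weil bound for Kloosterman sums is elementary here. If [K] is the sum over [F_Q], then the
   sum over the quadratic extension is [2 Q - K^2]; hence a violation of [|K| <= 2 sqrt Q] would
   grow along a tower of quadratic extensions, with negative sign. Stepanov's method in
   Bombieri's form, which needs no derivatives since the fields have square order, bounds from
   below a sum of such Kloosterman sums by a constant multiple of [sqrt Q], a contradiction. *)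

Require Import Defs.
From HB Require Import structures.
From mathcomp Require Import all_boot all_order all_algebra all_field.
From mathcomp Require Import qfpoly zify ring lra.
From mathcomp Require Import complex.
From mathcomp Require Import reals exp.

Set Implicit Arguments.
Unset Strict Implicit.
Unset Printing Implicit Defensive.

Import Order.TTheory GRing.Theory Num.Theory.

Local Open Scope ring_scope.

(** * Stepanov's method over a field of square order *)

(** The Weil bound rests on one-sided ingredients that happen to fit. The square in [K -> 2 Q - K^2]
    makes a violation negative after one step, whatever its sign before, so lower bounds suffice;
    this is the side obtained by counting the [y] with nonsquare value of [D], where the auxiliary
    polynomial vanishes. The curve [y^q - y = x + c/x] cannot isolate a character: it sees all the
    [psi (a x)] with [a != 0] together. The other terms cannot compensate for the violating one,
    because [2 Q - K^2 <= 2 Q] holds for each of them at no cost and there are fewer than [q] of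
    them, with [q] fixed while the tower is climbed. On the graph side, the bound on [delta] and the
    size of [q] enter through a single inequality: the [O(lam ..)] term must stay below the saving
    in the error. *)

Lemma sum_dvd_expX_eq0 (L : fieldType) (P M : nat) (f : nat -> {poly L}) :
  (forall i, 'X^P %| f i -> f i = 0) ->
  \sum_(i < M) f i * 'X^(i * P) = 0 -> forall i, (i < M)%N -> f i = 0.
Proof.
elim: M f => [//|M IH] f f_dvd; rewrite big_ord_recl mul0n expr0 mulr1 => sum0.
(* Modulo [X^P] only the term [i = 0] survives. The [f i] may have degree above [P], so this is not
   the uniqueness of an expansion in base [X^P]. *)
have f0 : f 0%N = 0.
  apply: f_dvd; move/eqP: sum0; rewrite addr_eq0 => /eqP ->.
  rewrite dvdpNr; apply: (big_ind (fun p => 'X^P %| p)) => [|p r|i _]; rewrite ?dvdp0 //.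
    exact: dvdp_add.
  by rewrite mulSn exprD; apply/dvdp_mull/dvdp_mulr.
case=> [//|i] ltiM; apply: (IH (fun i => f i.+1)) => // [j|]; first exact: f_dvd.
apply: (mulfI (_ : 'X^P != 0 :> {poly L})); first by rewrite expf_neq0 ?polyX_eq0.
rewrite f0 add0r in sum0; rewrite mulr0 -[RHS]sum0 big_distrr.
by apply: eq_bigr => j _ /=; rewrite /bump add1n mulSn exprD mulrCA.
Qed.

Lemma size_exp_bound (A : nzRingType) (p : {poly A}) (m n : nat) :
  (size p <= m -> size (p ^+ n) <= (m - 1) * n + 1)%N.
Proof.
move=> le_pm; apply: leq_trans (size_poly_exp_leq _ _) _.
by rewrite -addn1 leq_add2r leq_mul2r -subn1 leq_sub2r ?orbT.
Qed.

Lemma size_mul_bound (A : nzRingType) (p r : {poly A}) (m n : nat) :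
  (size p <= m -> size r <= n -> size (p * r)%R <= m + n - 1)%N.
Proof.
move=> le_pm le_rn; apply: leq_trans (size_polyMleq _ _) _.
by rewrite -subn1 leq_sub2r // leq_add.
Qed.

Lemma pchar_poly_nat (L : fieldType) (P : nat) :
  [pchar L].-nat P -> [pchar {poly L}].-nat P.
Proof. by apply: sub_in_pnat => p _ /(rmorph_pchar (@polyC L)). Qed.

Lemma exprB_pchar (A : comNzRingType) (P : nat) (x y : A) :
  [pchar A].-nat P -> (x - y) ^+ P = x ^+ P - y ^+ P.
Proof.
move=> pP; apply: (addIr (y ^+ P)); rewrite subrK -exprDn_pchar //.
by rewrite subrK.
Qed.

(** Frobenius turns the difference into [(D - D(0))^P], and [X] divides [D - D(0)]: modulo [X^P] a
    factor [D^P] is a constant. *)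
Lemma dvdp_expB_horner0 (L : fieldType) (P : nat) (D : {poly L}) :
  [pchar L].-nat P -> 'X^P %| D ^+ P - (D.[0] ^+ P)%:P.
Proof.
move=> pP; rewrite rmorphXn -exprB_pchar ?pchar_poly_nat //; apply: dvdp_exp2r.
by rewrite -['X]subr0 -polyC0 dvdp_XsubCl /root !hornerE subrr.
Qed.

Lemma pchar_nat_card (L : finFieldType) : [pchar L].-nat #|L|.
Proof.
have [p p_pr pcharLp] := finPcharP L.
rewrite (card_pprimeChar pcharLp) pnatX; apply/orP; left.
by rewrite pnatE.
Qed.

Section Stepanov.
Variables (L : finFieldType) (h e : nat) (D : {poly L}).
Let P := (2 * h - 1)%N.
Hypotheses (cardL : #|L| = (P ^ 2)%N) (sizeD : size D = (2 * e).+1).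
Hypotheses (D0 : D.[0] != 0) (e_gt0 : (0 < e)%N) (lt_eh : (e.+1 < h)%N).
Hypothesis D_sqf : forall (a d : {poly L}) (c : L),
  c != 0 -> a ^+ 2 = c *: (d ^+ 2 * D) -> d = 0.

Lemma pchar_nat_sqrt_card : [pchar L].-nat P.
Proof. by have := pchar_nat_card L; rewrite cardL pnatX orbF. Qed.

Let M := (h - 1 + e)%N.

(** As [2 h = P + 1], one has [(D^h)^2 = D * D^P], which is [D(0)^P * D] modulo [X^P]. Squaring
    [a = - d D^h] gives a congruence between [a^2] and [D(0)^P d^2 D]; both have size at most [P],
    so it is an equality, which [D_sqf] excludes unless [d = 0]. *)
Lemma stepanov_term_eq0 (a d : {poly L}) :
  (size a <= h)%N -> (size d <= h - e)%N ->
  'X^P %| a + d * D ^+ h -> a = 0 /\ d = 0.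
Proof.
move=> size_a size_d dvd_ad.
have kap0 : D.[0] ^+ P != 0 by rewrite expf_neq0.
suff sq : a ^+ 2 = D.[0] ^+ P *: (d ^+ 2 * D).
  have d0 := D_sqf kap0 sq; split=> //.
  by apply/eqP; rewrite -sqrf_eq0 sq d0 expr0n mul0r scaler0.
have dvd_sq : 'X^P %| a ^+ 2 - D.[0] ^+ P *: (d ^+ 2 * D).
  have DhE : D * D ^+ P = (D ^+ h) ^+ 2.
    by rewrite -exprS -exprM; congr (_ ^+ _); rewrite /P; lia.
  have -> : a ^+ 2 - D.[0] ^+ P *: (d ^+ 2 * D) =
    (a + d * D ^+ h) * (a - d * D ^+ h) + d ^+ 2 * D * (D ^+ P - (D.[0] ^+ P)%:P).
    have -> : d ^+ 2 * D * (D ^+ P - (D.[0] ^+ P)%:P) =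
      d ^+ 2 * (D * D ^+ P) - (D.[0] ^+ P)%:P * (d ^+ 2 * D) by ring.
    rewrite -mul_polyC DhE; ring.
  apply: dvdp_add; first exact: dvdp_mulr.
  exact/dvdp_mull/dvdp_expB_horner0/pchar_nat_sqrt_card.
apply/eqP; rewrite -subr_eq0; apply: contraTT dvd_sq => nz.
apply/negP => /(dvdp_leq nz); rewrite size_polyXn leqNgt => /negP; apply.
rewrite ltnS; apply: leq_trans (size_polyD _ _) _; rewrite size_polyN geq_max.
apply/andP; split.
  by apply: leq_trans (size_exp_bound 2 size_a) _; rewrite /P; lia.
apply: leq_trans (size_scale_leq _ _) _.
apply: leq_trans (size_mul_bound (size_exp_bound 2 size_d) (eq_leq sizeD)) _.
rewrite /P; lia.
Qed.


(* Where [y ^ Q = y] and [D(y) ^ ((Q-1)/2) = -1], with [Q = P^2], the [P]-th power of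
   [stepanov_poly u] takes the value of [stepanov_relation u]. *)
Definition stepanov_relation (u : 'M[L]_(M, h) * 'M[L]_(M, h - e)) : {poly L} :=
  \sum_i ((rVpoly (row i u.1)) ^+ P - (rVpoly (row i u.2)) ^+ P * D ^+ h) * 'X^i.

Definition stepanov_poly (u : 'M[L]_(M, h) * 'M[L]_(M, h - e)) : {poly L} :=
  \sum_i (rVpoly (row i u.1) + rVpoly (row i u.2) * D ^+ h) * 'X^(i * P).

Lemma stepanov_relationB u v :
  stepanov_relation (u - v) = stepanov_relation u - stepanov_relation v.
Proof.
rewrite -sumrB; apply: eq_bigr => i _; rewrite -mulrBl; congr (_ * _).
rewrite !linearB /= !exprB_pchar ?pchar_poly_nat ?pchar_nat_sqrt_card //.
ring.
Qed.

Lemma size_stepanov_relation u :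
  (size (stepanov_relation u) <= (h - 1) * P + e + M)%N.
Proof.
apply: leq_trans (size_sum _ _ _) _; apply/bigmax_leqP => i _.
have size1 := size_exp_bound P (size_poly _ _ : size (rVpoly (row i u.1)) <= h)%N.
have size2 := size_exp_bound P (size_poly _ _ : size (rVpoly (row i u.2)) <= h - e)%N.
have size3 := size_mul_bound size2 (size_exp_bound h (eq_leq sizeD)).
(* The shorter width [h - e] offsets the degree [2 e h] of [D^h], up to [e]. *)
have eqP : ((h - e - 1) * P + 2 * e * h = (h - 1) * P + e)%N.
  have P_eq : (2 * h = P + 1)%N by rewrite /P; lia.
  have -> : (h - 1 = (h - e - 1) + e)%N by lia.
  have -> : (2 * e * h = e * (P + 1))%N by rewrite -P_eq; lia.
  lia.
have size4 : (size ((rVpoly (row i u.1)) ^+ P - (rVpoly (row i u.2)) ^+ P * D ^+ h)%R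
    <= (h - 1) * P + e + 1)%N.
  apply: leq_trans (size_polyD _ _) _; rewrite size_polyN geq_max.
  apply/andP; split; [apply: leq_trans size1 _|apply: leq_trans size3 _]; lia.
apply: leq_trans (size_mul_bound size4 (leqnn _)) _.
rewrite size_polyXn; have := ltn_ord i; lia.
Qed.

Lemma stepanov_poly_neq0 u : u != 0 -> stepanov_poly u != 0.
Proof.
apply: contraNneq => A0.
pose f (j : nat) : {poly L} := if insub j is Some i then
  rVpoly (row i u.1) + rVpoly (row i u.2) * D ^+ h else 0.
have terms0 (i : 'I_M) : rVpoly (row i u.1) = 0 /\ rVpoly (row i u.2) = 0.
  have term_dvd (k : 'I_M) : 'X^P %| rVpoly (row k u.1) + rVpoly (row k u.2) * D ^+ h ->
      rVpoly (row k u.1) = 0 /\ rVpoly (row k u.2) = 0.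
    exact: stepanov_term_eq0 (size_poly _ _) (size_poly _ _).
  apply: (term_dvd); suff fi0 : f i = 0 by move: fi0; rewrite /f valK => ->; rewrite dvdp0.
  apply: (@sum_dvd_expX_eq0 L P M f) => // [j|].
    rewrite /f; case: insubP => // k _ _ /term_dvd[-> ->]; by rewrite mul0r addr0.
  by rewrite -[RHS]A0; apply: eq_bigr => k _; rewrite /f valK.
case: u {A0 f} terms0 => a d /= terms0; apply/eqP; congr (_, _); apply/row_matrixP => i.
  by rewrite row0 -[row i a]rVpolyK (terms0 i).1 linear0.
by rewrite row0 -[row i d]rVpolyK (terms0 i).2 linear0.
Qed.

(** [y^(P^2) = y], and [h P = h + (Q-1)/2] gives [D(y)^(h P) = - D(y)^h], whence the minus sign in
    [stepanov_relation]. A value whose [P]-th power vanishes is zero, so no derivative is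
    involved. *)
Lemma stepanov_poly_root u y :
  stepanov_relation u = 0 -> D.[y] ^+ (#|L|.-1./2) = -1 -> root (stepanov_poly u) y.
Proof.
move=> rel0 Dy; have yQ : y ^+ P ^+ P = y by rewrite -exprM mulnn -cardL expf_card.
suff: (stepanov_poly u).[y] ^+ P == 0 by rewrite expf_eq0 => /andP[].
apply/eqP; move/(congr1 (horner^~ y)): rel0; rewrite !horner_sum horner0 => rel0.
have pP := pchar_nat_sqrt_card.
have expP_sum (f : 'I_M -> L) : (\sum_i f i) ^+ P = \sum_i f i ^+ P.
  elim/big_rec2: _ => [|i x z _ <-]; last by rewrite exprDn_pchar.
  by rewrite expr0n; case: eqP => // P0; move: lt_eh; rewrite /P in P0; lia.
rewrite expP_sum -[RHS]rel0; apply: eq_bigr => i _.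
have DyhP : D.[y] ^+ h ^+ P = - D.[y] ^+ h.
  rewrite -exprM -mulN1r -Dy -exprD; congr (_ ^+ _).
  have -> : (#|L|.-1 = (2 * (h * P - h)))%N by rewrite cardL /P; nia.
  by rewrite mul2n doubleK; rewrite /P; nia.
rewrite !hornerE /= exprMn exprDn_pchar // exprMn DyhP -exprM.
by rewrite mulrN -mulnA mulnC exprM [y ^+ (P * P)]exprM yQ.
Qed.

(** Pigeonhole: [M (2 h - e)] free coefficients against at most [(h - 1) P + e + M] coefficients in
    the image. With [M = h - 1 + e] the surplus is [e (h - e - 1)], positive by [lt_eh]. *)
Lemma stepanov_relation_nontrivial : exists2 u, u != 0 & stepanov_relation u = 0.
Proof.
pose S := ((h - 1) * P + e + M)%N.
pose phi u : 'rV[L]_S := poly_rV (stepanov_relation u).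
have : ~~ injectiveb phi.
  apply/negP => /injectiveP /leq_card; apply/negP; rewrite -ltnNge.
  rewrite card_prod !card_mx -expnD ltn_exp2l ?finRing_gt1 // /S /M /P.
  have [k ->] : exists k, h = (e + 2 + k)%N by exists (h - e - 2)%N; lia.
  have [e' ->] : exists e', e = e'.+1 by exists e.-1; lia.
  have -> : (2 * (e'.+1 + 2 + k) - 1 = 2 * e' + 2 * k + 5)%N by lia.
  have -> : (e'.+1 + 2 + k - 1 = e' + k + 2)%N by lia.
  have -> : (e'.+1 + 2 + k - e'.+1 = k + 2)%N by lia.
  nia.
rewrite /injectiveb => /injectivePn [u [v neq_uv eq_phi]].
exists (u - v); first by rewrite subr_eq0.
rewrite stepanov_relationB; apply/eqP; rewrite subr_eq0.
rewrite -(poly_rV_K (size_stepanov_relation u)) -/(phi u) eq_phi.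
by rewrite poly_rV_K ?size_stepanov_relation.
Qed.

Lemma size_stepanov_poly u :
  (size (stepanov_poly u) <= h + e * P + (M - 1) * P)%N.
Proof.
apply: leq_trans (size_sum _ _ _) _; apply/bigmax_leqP => i _.
have size2 := size_mul_bound (size_poly _ _ : size (rVpoly (row i u.2)) <= h - e)%N
  (size_exp_bound h (eq_leq sizeD)).
have size4 : (size (rVpoly (row i u.1) + (rVpoly (row i u.2)) * D ^+ h)%R
    <= h + e * P)%N.
  apply: leq_trans (size_polyD _ _) _; rewrite geq_max; apply/andP; split.
    by apply: leq_trans (size_poly _ _) _; rewrite leq_addr.
  apply: leq_trans size2 _.
  have -> : (((2 * e).+1 - 1) * h = e * (P + 1))%N by rewrite /P; nia.
  lia.
apply: leq_trans (size_mul_bound size4 (leqnn _)) _.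
have : (i * P <= (M - 1) * P)%N by rewrite leq_mul2r; have := ltn_ord i; lia.
rewrite size_polyXn; lia.
Qed.

(** The degree is about [(h + 2 e) P], and [h P] is about [#|L| / 2]: the plain bound on the number
    of roots already has the right leading term. *)
Lemma stepanov_bound :
  (2 * #|[set y | (D.[y] ^+ (#|L|.-1./2) == -1)%R]| <= #|L| + 4 * e * P)%N.
Proof.
have [u u_neq0 rel0] := stepanov_relation_nontrivial.
set S := [set y | _].
have := @max_poly_roots L (stepanov_poly u) (enum S) (stepanov_poly_neq0 u_neq0).
rewrite enum_uniq -cardE => /(_ _ isT) lt_card.
have {lt_card} lt_card : (#|S| < size (stepanov_poly u))%N.
  apply: lt_card; apply/allP => y; rewrite mem_enum inE => /eqP.
  exact: stepanov_poly_root.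
have := leq_trans lt_card (size_stepanov_poly u); rewrite cardL.
have -> : ((M - 1) * P = (h - 2) * P + e * P)%N by rewrite /M -mulnDl; congr (_ * _)%N; lia.
have -> : (P ^ 2 = 2 * ((h - 2) * P) + 3 * P)%N by rewrite /P; nia.
rewrite /P; lia.
Qed.

End Stepanov.

(** * Quadratic characters and quadratic extensions *)

Section QuadraticCharacter.
Variables (F : finFieldType).
Hypothesis oddF : odd #|F|.

Lemma natr2_neq0 : 2%:R != 0 :> F.
Proof.
apply/eqP => two0; have [p p_pr pcharFp] := finPcharP F.
have p2 : p = 2%N.
  have : (2 : nat) \in [pchar F] by rewrite inE /= two0.
  by rewrite (pcharf_eq pcharFp) => /eqP.
have := card_pprimeChar pcharFp; set n := logn _ _ => cardF.
move: oddF (finRing_gt1 F); rewrite [#|F|]cardF p2 oddX /=.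
by case: n {cardF}.
Qed.

Lemma natr4_neq0 : 4%:R != 0 :> F.
Proof. by have := natr2_neq0; rewrite (natrM _ 2 2) mulf_eq0 orbb. Qed.

Lemma card_pred_half : (#|F|.-1 = 2 * #|F|.-1./2)%N.
Proof.
by rewrite mul2n -[LHS]odd_double_half; move: oddF (finRing_gt1 F); case: #|F| => //= n /negbTE ->.
Qed.

Lemma expf_card_pred (x : F) : x != 0 -> x ^+ #|F|.-1 = 1.
Proof.
move=> x_neq0; apply: (mulfI x_neq0); rewrite -exprS prednK ?expf_card ?mulr1 //.
exact: ltnW (finRing_gt1 F).
Qed.

Definition quad_char (A : pzRingType) (x : F) : A :=
  if x == 0 then 0 else if x ^+ #|F|.-1./2 == 1 then 1 else -1.

Lemma quad_char0 (A : pzRingType) : quad_char A 0 = 0.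
Proof. by rewrite /quad_char eqxx. Qed.

Lemma expf_half_card (x : F) : x != 0 ->
  x ^+ #|F|.-1./2 = 1 \/ x ^+ #|F|.-1./2 = -1.
Proof.
move=> /expf_card_pred; rewrite {1}card_pred_half mulnC exprM => /eqP.
rewrite sqrf_eq1 => /orP[] /eqP; by [left|right].
Qed.

Lemma oppr1_eq1 : (-1 == 1 :> F) = false.
Proof. by apply/negbTE; rewrite eq_sym -subr_eq0 opprK; exact: natr2_neq0. Qed.

Lemma quad_charM (A : pzRingType) (x y : F) :
  quad_char A (x * y) = quad_char A x * quad_char A y.
Proof.
rewrite /quad_char mulf_eq0; have [->|x0] := eqVneq x 0; first by rewrite /= mul0r.
have [->|y0] /= := eqVneq y 0; first by rewrite mulr0.
rewrite exprMn.
by case: (expf_half_card x0) => ->; case: (expf_half_card y0) => ->;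
  rewrite ?(mulr1, mul1r, mulrNN, eqxx, oppr1_eq1) ?(mulr1, mul1r, mulrNN).
Qed.

Lemma quad_char_sqr (A : pzRingType) (x : F) : x != 0 -> quad_char A (x ^+ 2) = 1.
Proof.
move=> x0; rewrite /quad_char sqrf_eq0 (negPf x0) -exprM -card_pred_half.
by rewrite expf_card_pred ?eqxx.
Qed.

Lemma quad_char_sqr_eq1 (A : pzRingType) (x : F) :
  x != 0 -> quad_char A x ^+ 2 = 1.
Proof.
move=> x0; rewrite /quad_char (negPf x0).
by case: ifP; rewrite ?expr1n ?sqrrN ?expr1n.
Qed.

(* When [x ^ ((q-1)/2) = 1], the polynomial [X^2 - x] divides [X^q - X], which splits. *)
Lemma sqrt_exists (x : F) : x ^+ #|F|.-1./2 = 1 -> exists w, w ^+ 2 = x.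
Proof.
move=> xh; have : 'X^2 - x%:P %| 'X^#|F| - 'X.
  have -> : 'X^#|F| - 'X = 'X * ('X^(#|F|.-1) - 1) :> {poly F}.
    by rewrite mulrBr mulr1 -exprS prednK // ltnW ?finRing_gt1.
  apply: dvdp_mull.
  rewrite {1}card_pred_half exprM -[1]polyC1 -xh polyC_exp.
  by rewrite subrXX dvdp_mulr.
rewrite finField_genPoly => /dvdp_prod_XsubC [m].
case def_rs: (mask m _) => [|w rs].
  by rewrite big_nil => /eqp_size; rewrite size_XnsubC // size_poly1.
rewrite big_cons => /eqp_root/(_ w); rewrite rootM root_XsubC eqxx /root.
by rewrite !hornerE subr_eq0 => /eqP ww; exists w.
Qed.

Lemma card_sqrt (A : pzRingType) (x : F) :
  #|[set w | w ^+ 2 == x]|%:R = 1 + quad_char A x.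
Proof.
rewrite /quad_char; have [->|x0] := eqVneq x 0.
  rewrite addr0 (_ : [set w | _] = [set 0]) ?cards1 //.
  by apply/setP => w; rewrite !inE sqrf_eq0.
have [xh|xh] := eqVneq _ 1.
  have [w wx] := sqrt_exists xh.
  have -> : [set v | v ^+ 2 == x] = [set w; - w].
    by apply/setP => v; rewrite !inE -wx eqf_sqr.
  suff -> : #|[set w; - w]| = 2%N by [].
  rewrite cards2 -addr_eq0 -mulr2n -mulr_natl mulf_eq0 (negPf natr2_neq0) /=.
  by have [w0|//] := eqVneq w 0; rewrite -wx w0 expr0n eqxx in x0.
rewrite subrr (_ : [set w | _] = set0) ?cards0 //.
apply/setP => w; rewrite !inE; apply: contraNF xh => /eqP wx.
by rewrite -wx -exprM -card_pred_half expf_card_pred // -sqrf_eq0 wx.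
Qed.

Lemma card_quadratic_roots (A : pzRingType) (u v : F) :
  #|[set x | x ^+ 2 - u * x + v == 0]|%:R = 1 + quad_char A (u ^+ 2 - 4 * v).
Proof.
rewrite -card_sqrt; congr _%:R; rewrite -(card_imset _ (_ : injective (fun x => 2 * x - u))).
  congr #|pred_of_set _|; apply/setP => w; rewrite inE; apply/imsetP/idP.
    case=> x; rewrite inE => /eqP x0 ->; apply/eqP.
    transitivity (u ^+ 2 - 4 * v + 4 * (x ^+ 2 - u * x + v)); first by ring.
    by rewrite x0 mulr0 addr0.
  move=> /eqP ww; exists ((w + u) / 2); last by field; exact: natr2_neq0.
  rewrite inE; apply/eqP; transitivity ((w ^+ 2 - (u ^+ 2 - 4 * v)) / 4).
    by field; rewrite natr2_neq0 natr4_neq0.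
  by rewrite ww subrr mul0r.
by move=> x y /addIr /(mulfI natr2_neq0).
Qed.

End QuadraticCharacter.

Section QuadraticExtension.
Variables (K L : finFieldType) (iota : {rmorphism K -> L}).
Hypotheses (oddK : odd #|K|) (cardL : #|L| = (#|K| ^ 2)%N).
Let q := #|K|.

Lemma iota_expf_card (u : K) : iota u ^+ q = iota u.
Proof. by rewrite -rmorphXn expf_card. Qed.

Lemma expfD_card (x y : L) : (x + y) ^+ q = x ^+ q + y ^+ q.
Proof.
by apply: exprDn_pchar; have := pchar_nat_card L; rewrite cardL pnatX orbF.
Qed.

Lemma expf_card_card (x : L) : x ^+ q ^+ q = x.
Proof. by rewrite -exprM mulnn -cardL expf_card. Qed.

Lemma expfB_card (x y : L) : (x - y) ^+ q = x ^+ q - y ^+ q.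
Proof. by apply: (addIr (y ^+ q)); rewrite -expfD_card !subrK. Qed.

Lemma fixed_in_iota (x : L) : x ^+ q = x -> exists u, iota u = x.
Proof.
move=> xq; case: (pickP (fun u => iota u == x)) => [u /eqP|no_u]; first by exists u.
pose rs := x :: [seq iota u | u <- enum K].
have q_gt1 : (1 < q)%N := finRing_gt1 K.
have size_p : size ('X^q - 'X : {poly L}) = q.+1.
  by rewrite size_polyDl ?size_polyXn // size_polyN size_polyX.
have := @max_poly_roots L ('X^q - 'X) rs; rewrite -size_poly_eq0 size_p => /(_ isT).
rewrite /= size_map -cardE ltnn map_inj_uniq ?enum_uniq ?andbT; last exact: fmorph_inj.
move=> absurd; suff: false by []; apply: absurd.
  rewrite /root !hornerE xq subrr eqxx /=; apply/allP => _ /mapP[u _ ->].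
  by rewrite /root !hornerE iota_expf_card subrr.
by apply/mapP => -[u _ xu]; have := no_u u; rewrite xu eqxx.
Qed.

(** [z + z^q] is fixed by the [q]-th power, hence lies in the image of [iota] once [#|L| = q^2]; the
    default [0] is then never returned. The same applies to the norm. *)
Definition ext_trace (z : L) : K := odflt 0 [pick u | iota u == z + z ^+ q].
Definition ext_norm (z : L) : K := odflt 0 [pick u | iota u == z * z ^+ q].

Lemma iota_ext_trace z : iota (ext_trace z) = z + z ^+ q.
Proof.
rewrite /ext_trace; case: pickP => [u /eqP //|] no_u.
have [|u uE] := @fixed_in_iota (z + z ^+ q).
  by rewrite expfD_card expf_card_card addrC.
by have := no_u u; rewrite uE eqxx.
Qed.

Lemma iota_ext_norm z : iota (ext_norm z) = z * z ^+ q.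
Proof.
rewrite /ext_norm; case: pickP => [u /eqP //|] no_u.
have [|u uE] := @fixed_in_iota (z * z ^+ q).
  by rewrite exprMn expf_card_card mulrC.
by have := no_u u; rewrite uE eqxx.
Qed.

Lemma ext_traceD : {morph ext_trace : x y / x + y}.
Proof.
move=> x y; apply: (fmorph_inj iota); rewrite rmorphD !iota_ext_trace expfD_card.
ring.
Qed.

Lemma ext_norm_eq0 z : (ext_norm z == 0) = (z == 0).
Proof. by rewrite -(fmorph_eq0 iota) iota_ext_norm -exprS expf_eq0. Qed.

Lemma ext_trace_iota u : ext_trace (iota u) = 2 * u.
Proof.
apply: (fmorph_inj iota).
by rewrite iota_ext_trace iota_expf_card rmorphM rmorph_nat mulr_natl mulr2n.
Qed.

Lemma odd_cardL : odd #|L|. Proof. by rewrite cardL oddX oddK. Qed.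

(** [(q^2 - 1)/2] is a multiple of [q - 1]: every element of [K] becomes a square in [L]. *)
Lemma quad_char_iota (A : pzRingType) (u : K) : u != 0 -> quad_char A (iota u) = 1.
Proof.
move=> u0; rewrite /quad_char fmorph_eq0 (negPf u0) -rmorphXn.
have -> : (#|L|.-1./2 = #|K|.-1 * (#|K|.+1)./2)%N.
  have [m cardK] : exists m, #|K| = (2 * m + 1)%N.
    by exists #|K|./2; rewrite -{1}[#|K|]odd_double_half oddK mul2n addnC.
  rewrite cardL cardK; have -> : ((2 * m + 1) ^ 2).-1 = (2 * (2 * m * (m + 1)))%N by lia.
  have -> : (2 * m + 1).+1 = (2 * (m + 1))%N by lia.
  have half2 k : (2 * k)./2 = k by rewrite mul2n doubleK.
  rewrite !half2; lia.
by rewrite exprM expf_card_pred // expr1n rmorph1 eqxx.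
Qed.

(** Put [w = 2 z - u = z - z^q]. The conditions become [w^2 = u^2 - 4 v] and [w^q = - w]. Since
    [w^q = w (u^2 - 4 v)^((q-1)/2)], the square roots that qualify are those of a nonsquare of [K],
    or [0]. *)
Lemma card_ext_trace_norm (A : pzRingType) (u v : K) :
  #|[set z | (ext_trace z == u) && (ext_norm z == v)]|%:R = 1 - quad_char A (u ^+ 2 - 4 * v).
Proof.
have two0 := natr2_neq0 odd_cardL.
set Dl := _ - 4 * v.
have -> : #|[set z | (ext_trace z == u) && (ext_norm z == v)]| =
    #|[set w | (w ^+ 2 == iota Dl) && (w ^+ q == - w)]|.
  rewrite -(card_imset _ (_ : injective (fun z => 2 * z - iota u))); last first.
    by move=> x y /addIr /(mulfI two0).
  congr #|pred_of_set _|; apply/setP => w; rewrite inE; apply/imsetP/andP.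
    case=> z; rewrite inE -!(inj_eq (fmorph_inj iota)) iota_ext_trace iota_ext_norm.
    move=> /andP[/eqP zu /eqP zv] ->; split; apply/eqP.
      rewrite rmorphB rmorphXn rmorphM rmorph_nat -zu -zv; ring.
    have -> : 2 * z - iota u = z - z ^+ q by rewrite -zu; ring.
    by rewrite expfB_card expf_card_card opprB.
  case=> /eqP ww /eqP wq; exists ((w + iota u) / 2); last by field.
  rewrite inE -!(inj_eq (fmorph_inj iota)) iota_ext_trace iota_ext_norm.
  have zq : ((w + iota u) / 2) ^+ q = (- w + iota u) / 2.
    by rewrite exprMn exprVn expfD_card wq iota_expf_card -(rmorph_nat iota) iota_expf_card.
  rewrite zq; apply/andP; split; apply/eqP; first by field.
  transitivity ((iota u ^+ 2 - w ^+ 2) / 4); first by field; rewrite two0 natr4_neq0 // odd_cardL.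
  rewrite ww /Dl rmorphB rmorphXn rmorphM rmorph_nat; field; exact: natr4_neq0 odd_cardL.
rewrite /quad_char; have [->|D0] := eqVneq Dl 0.
  rewrite subr0 rmorph0 (_ : [set w | _] = [set 0]) ?cards1 //.
  apply/setP => w; rewrite !inE sqrf_eq0; have [->|//] := eqVneq w 0.
  by rewrite expr0n oppr0 eqn0Ngt (ltnW (finRing_gt1 K)) eqxx.
have wqE w : w ^+ 2 = iota Dl -> w ^+ q = w * iota (Dl ^+ (#|K|.-1./2)).
  move=> ww; rewrite rmorphXn -ww -exprM -card_pred_half // -exprS prednK //.
  exact: ltnW (finRing_gt1 K).
have w_neq0 w : w ^+ 2 = iota Dl -> w != 0.
  by move=> ww; rewrite -sqrf_eq0 ww fmorph_eq0.
have [Dh|Dh] := eqVneq _ 1.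
  rewrite subrr (_ : [set w | _] = set0) ?cards0 //; apply/setP => w; rewrite !inE.
  apply/negP => /andP[/eqP ww /eqP]; rewrite (wqE _ ww) Dh rmorph1 mulr1 => /eqP.
  by rewrite -addr_eq0 -mulr2n -mulr_natl mulf_eq0 (negPf two0) (negPf (w_neq0 _ ww)).
have {}Dh : Dl ^+ #|K|.-1./2 = -1.
  by case: (expf_half_card oddK D0) => // DE; rewrite DE eqxx in Dh.
rewrite opprK; transitivity (1 + quad_char A (iota Dl)); last by rewrite quad_char_iota.
rewrite -(card_sqrt odd_cardL); congr _%:R.
apply: eq_card => w; rewrite !inE; have [ww|//] := eqVneq _ (iota Dl).
by rewrite (wqE _ ww) Dh rmorphN1 mulrN1 eqxx.
Qed.

End QuadraticExtension.

(** * Kloosterman sums and the Weil bound *)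

Lemma sum_fiber (I J : finType) (A : nmodType) (p : I -> J) (P : pred J) (g : J -> A) :
  \sum_(i | P (p i)) g (p i) = \sum_(j | P j) g j *+ #|[set i | p i == j]|.
Proof.
rewrite (partition_big p P) //=; apply: eq_bigr => j Pj.
rewrite -sumr_const; apply: eq_big => [i|i /andP[_ /eqP ->] //].
by rewrite inE; case: eqP => [->|]; rewrite ?Pj ?andbF.
Qed.

Definition additive_char (F : finFieldType) (C : pzRingType) (psi : F -> C) : Prop :=
  psi 0 = 1 /\ {morph psi : x y / x + y >-> x * y}.

Definition nontrivial_char (F : finFieldType) (C : pzRingType) (psi : F -> C) : Prop :=
  exists a, psi a <> 1.

Section AdditiveCharacter.
Variables (F : finFieldType) (C : numClosedFieldType) (psi : F -> C).
Hypotheses (psi_add : additive_char psi) (psi_nt : nontrivial_char psi).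

Lemma additive_charX x n : psi (x *+ n) = psi x ^+ n.
Proof.
by elim: n => [|n IH]; rewrite ?mulr0n ?(psi_add.1) // mulrS (psi_add.2) IH exprS.
Qed.

Lemma additive_char_norm x : `|psi x| = 1.
Proof.
have q_gt0 : (0 < #|F|)%N := ltnW (finRing_gt1 F).
suff: `|psi x| ^+ #|F| == 1.
  by rewrite pexprn_eq1 ?normr_ge0 // eqn0Ngt q_gt0 => /eqP.
rewrite -normrX -additive_charX.
have [p p_pr pcharFp] := finPcharP F.
suff -> : x *+ #|F| = 0 by rewrite psi_add.1 normr1.
rewrite (card_pprimeChar pcharFp); case: (logn _ _) (card_pprimeChar pcharFp) => [cardF|n _].
  by have := finRing_gt1 F; rewrite [#|F|]cardF.
by rewrite expnS mulrnA -(mulr_natl x) (pcharf0 pcharFp) mul0r mul0rn.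
Qed.

Lemma conj_additive_char x : (psi x)^* = psi (- x).
Proof.
have x0 : psi x != 0 by rewrite -normr_eq0 additive_char_norm oner_eq0.
apply: (mulfI x0); rewrite -normCK additive_char_norm expr1n -psi_add.2 subrr.
by rewrite psi_add.1.
Qed.

Lemma sum_additive_char : \sum_x psi x = 0.
Proof.
have [a a1] := psi_nt; have : psi a * (\sum_x psi x) = \sum_x psi x.
  rewrite big_distrr /= [RHS](reindex_inj (addrI a)).
  by apply: eq_bigr => x _; rewrite psi_add.2.
move=> /eqP; rewrite -subr_eq0 -{2}[\sum_x _]mul1r -mulrBl mulf_eq0 subr_eq0.
by case: eqP a1 => //= _ _ /eqP.
Qed.

Lemma sum_additive_charM (b : F) : \sum_x psi (x * b) = if b == 0 then #|F|%:R else 0.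
Proof.
case: eqP => [->|/eqP b0].
  by under eq_bigr do rewrite mulr0 psi_add.1; rewrite sumr_const.
by rewrite -[RHS]sum_additive_char [RHS](reindex_inj (mulIf b0)).
Qed.

End AdditiveCharacter.

Definition kloosterman (F : finFieldType) (C : pzRingType) (psi : F -> C) (c : F) : C :=
  \sum_(x | x != 0) psi (x + c / x).

Lemma sum_add_div (F : finFieldType) (C : pzRingType) (g : F -> C) (c : F) :
  odd #|F| -> c != 0 ->
  \sum_(x | x != 0) g (x + c / x) = \sum_u g u * (1 + quad_char C (u ^+ 2 - 4 * c)).
Proof.
move=> oddF c0; rewrite (partition_big (fun x => x + c / x) xpredT) //=.
apply: eq_bigr => u _; rewrite -card_quadratic_roots // mulr_natr -sumr_const.
apply: eq_big => [x|x /andP[_ /eqP -> //]]; rewrite inE.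
have [->|x0] := eqVneq x 0; first by rewrite expr0n /= mulr0 subr0 add0r (negPf c0).
rewrite /= -subr_eq0 -(inj_eq (mulfI x0)) mulr0; congr (_ == _); by field.
Qed.

Lemma sum_quad_char_sqr_sub (F : finFieldType) (C : pzRingType) (c : F) :
  odd #|F| -> c != 0 -> \sum_u quad_char C (u ^+ 2 - 4 * c) = -1.
Proof.
move=> oddF c0; have := sum_add_div (fun=> 1 : C) oddF c0.
under [in RHS]eq_bigr do rewrite mul1r.
rewrite big_split /= [X in _ = X + _](bigD1 0) //= -addrA addrCA -[X in X = _]addr0.
by move=> /addrI/esym/eqP; rewrite addrC addr_eq0 => /eqP.
Qed.

Section Kloosterman.
Variables (F : finFieldType) (C : numClosedFieldType) (psi : F -> C).
Hypotheses (oddF : odd #|F|) (psi_add : additive_char psi) (psi_nt : nontrivial_char psi).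

Lemma kloosterman_quad_char (c : F) : c != 0 ->
  kloosterman psi c = \sum_u psi u * quad_char C (u ^+ 2 - 4 * c).
Proof.
move=> c0; rewrite /kloosterman sum_add_div //.
under eq_bigr do rewrite mulrDr mulr1.
by rewrite big_split /= sum_additive_char // add0r.
Qed.

Lemma conj_kloosterman c : (kloosterman psi c)^* = kloosterman psi c.
Proof.
rewrite /kloosterman rmorph_sum [RHS](reindex_inj oppr_inj) /=.
apply: eq_big => [x|x _]; first by rewrite oppr_eq0.
by rewrite conj_additive_char // invrN mulrN -opprD.
Qed.

Lemma kloosterman_real c : kloosterman psi c \is Num.real.
Proof. by apply/CrealP/conj_kloosterman. Qed.

Variables (L : finFieldType) (iota : {rmorphism F -> L}).
Hypothesis cardL : #|L| = (#|F| ^ 2)%N.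

(* Both sides are sums over the values [(u, v)] of (trace, norm) on [L], respectively of
   (sum, product) on pairs from [F]; a value is taken [1 - eta(u^2-4v)], respectively
   [1 + eta(u^2-4v)], times, so the quadratic characters cancel. *)
Lemma kloosterman_ext (c : F) : c != 0 ->
  kloosterman (fun z => psi (ext_trace iota z)) (iota c) = 2 * #|F|%:R - kloosterman psi c ^+ 2.
Proof.
(* Both [x + c/x + y + c/y] and the trace of [z + c/z] equal [u (1 + c/v)]. *)
move=> c0; pose g (uv : F * F) := psi (uv.1 * (1 + c / uv.2)).
have KL : kloosterman (fun z => psi (ext_trace iota z)) (iota c) =
    \sum_(uv : F * F | uv.2 != 0) g uv * (1 - quad_char C (uv.1 ^+ 2 - 4 * uv.2)).
  transitivity (\sum_(z | ext_norm iota z != 0) g (ext_trace iota z, ext_norm iota z)).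
    apply: eq_big => [z|z z0]; first by rewrite ext_norm_eq0.
    rewrite /g /=; congr psi; apply: (fmorph_inj iota).
    rewrite rmorphM rmorphD rmorph1 rmorphM fmorphV.
    rewrite !iota_ext_trace // iota_ext_norm //.
    rewrite expfD_card // exprMn exprVn iota_expf_card; field.
    by rewrite expf_neq0.
  apply: etrans
    (sum_fiber (fun z => (ext_trace iota z, ext_norm iota z)) (fun uv => uv.2 != 0) g) _.
  apply: eq_bigr => -[u v] _ /=; rewrite -(card_ext_trace_norm iota) // mulr_natr.
  by congr (_ *+ _); apply: eq_card => z; rewrite !inE.
have KK : kloosterman psi c ^+ 2 =
    \sum_(uv : F * F | uv.2 != 0) g uv * (1 + quad_char C (uv.1 ^+ 2 - 4 * uv.2)).
  transitivity (\sum_(xy : F * F | xy.1 * xy.2 != 0) g (xy.1 + xy.2, xy.1 * xy.2)).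
    rewrite expr2 /kloosterman big_distrlr /= pair_big /=.
    apply: eq_big => [xy|[x y] /andP[/= x0 y0]]; first by rewrite mulf_eq0 negb_or.
    by rewrite /g /= -psi_add.2; congr psi; field; rewrite ?x0 ?y0.
  apply: etrans
    (sum_fiber (fun xy : F * F => (xy.1 + xy.2, xy.1 * xy.2)) (fun uv => uv.2 != 0) g) _.
  apply: eq_bigr => -[u v] _ /=; rewrite -card_quadratic_roots // mulr_natr.
  congr (_ *+ _); rewrite -(card_imset _ (_ : injective (fun x => (x, u - x)))); last first.
    by move=> x y [].
  apply: eq_card => -[x y]; rewrite inE /=; apply/eqP/imsetP.
    case=> <- <-; exists x; first by rewrite inE; apply/eqP; ring.
    by congr (_, _); ring.
  case=> x' + [-> ->]; rewrite inE => /eqP x'0; congr (_, _); first by ring.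
  by apply/eqP; rewrite -subr_eq0 -oppr_eq0 -x'0; apply/eqP; ring.
apply/eqP; rewrite -subr_eq0 KL KK opprB addrA subr_eq0 -big_split /=.
apply/eqP; transitivity (2 * \sum_(v | v != 0) \sum_u g (u, v)).
  rewrite (exchange_big_dep predT) //= pair_big_dep /= big_distrr /=.
  by apply: eq_big => [[u v]|[u v] _] /=; [rewrite andbT|ring].
(* The character [u -> psi (u (1 + c/v))] is trivial only for [v = - c]. *)
congr (_ * _); rewrite (bigD1 (- c)) ?oppr_eq0 //= [X in _ + X]big1 => [|v /andP[v0 vc]].
  by rewrite addr0 /g /= sum_additive_charM // invrN mulrN divff // subrr eqxx.
rewrite /g /= sum_additive_charM //; case: eqP => // /(congr1 ( *%R v)).
rewrite mulr0 mulrDr mulr1 mulrCA divff // mulr1 => /eqP.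
by rewrite addr_eq0 (negPf vc).
Qed.

End Kloosterman.

(** * Towers of quadratic extensions *)

Lemma nonsquare_exists (F : finFieldType) : odd #|F| -> exists e : F, forall w, w ^+ 2 != e.
Proof.
move=> oddF; case: (pickP (fun e : F => [forall w, w ^+ 2 != e])) => [e /forallP|no_e].
  by exists e.
have sqr_inj : injective (fun w : F => w ^+ 2).
  apply/injectiveP; rewrite /injectiveb /dinjectiveb.
  apply: leq_size_uniq (enum_uniq F) _ _; last by rewrite size_map.
  move=> e _; have /forallPn[w /negPn/eqP we] := negbT (no_e e).
  by apply/mapP; exists w; rewrite ?mem_enum.
have /eqP := sqr_inj 1 (-1) (esym (sqrrN 1)).
by rewrite eq_sym oppr1_eq1.
Qed.

Lemma quadratic_ext_exists (F : finFieldType) : odd #|F| ->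
  exists (L : finFieldType) (iota : {rmorphism F -> L}), #|L| = (#|F| ^ 2)%N.
Proof.
move=> /nonsquare_exists [e e_nsq]; pose h : {poly F} := 'X^2 - e%:P.
have size_h : size h = 3%N by rewrite size_XnsubC.
have hI : monic_irreducible_poly h.
  split; last exact: monicXnsubC.
  apply: cubic_irreducible; first by rewrite size_h.
  by move=> x; rewrite /root !hornerE subr_eq0 e_nsq.
exists ({poly %/ h with hI} : finFieldType), (in_alg {poly %/ h with hI}).
by rewrite card_qfpoly size_h.
Qed.

Section Additive.
Variables (A B : finZmodType) (f : A -> B).
Hypothesis fD : {morph f : x y / x + y}.

Lemma additive0 : f 0 = 0.
Proof. by apply: (addIr (f 0)); rewrite -fD !add0r. Qed.

Lemma card_additive_fiber (x0 : A) : #|[set x | f x == f x0]| = #|[set x | f x == 0]|.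
Proof.
rewrite -(card_imset [set x | f x == 0] (addrI x0)); apply: eq_card => x.
rewrite inE; apply/eqP/imsetP => [fx|[y]].
  exists (x - x0); last by rewrite addrC subrK.
  by rewrite inE -(inj_eq (addIr (f x0))) -fD subrK fx add0r.
by rewrite inE => /eqP fy ->; rewrite fD fy addr0.
Qed.

Lemma sum_additive (M : nmodType) (g : B -> M) :
  \sum_x g (f x) = \sum_(u in f @: setT) g u *+ #|[set x | f x == 0]|.
Proof.
rewrite (partition_big f (mem (f @: setT))) => [|x _]; last exact: imset_f.
apply: eq_bigr => _ /imsetP[x0 _ ->]; rewrite -(card_additive_fiber x0) -sumr_const.
by apply: eq_big => [x|x /eqP -> //]; rewrite inE.
Qed.

Lemma card_additive : (#|A| = #|f @: setT| * #|[set x | f x == 0%R]|)%N.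
Proof.
have := sum_additive (fun=> 1 : int); rewrite !sumr_const => /eqP.
by rewrite -mulrnA eqr_nat mulnC => /eqP.
Qed.

End Additive.

(* If [K] is a Kloosterman sum over [F_q], then [doubling_seq q K j] is the corresponding sum
   over the extension of degree [2^j]. *)
Fixpoint doubling_seq (C : pzRingType) (q : nat) (x : C) (j : nat) : C :=
  if j is i.+1 then 2 * (q ^ (2 ^ i))%:R - doubling_seq q x i ^+ 2 else x.

(** [tr] is kept abstract: additivity, surjectivity and Frobenius invariance are what the later
    count of its kernel needs. The extension is chosen before [psi], since one [L] has to serve all
    the characters [psi (a x)] at once. *)
Lemma kloosterman_tower (C : numClosedFieldType) (F : finFieldType) (j : nat) : odd #|F| ->
  exists (L : finFieldType) (iota : {rmorphism F -> L}) (tr : L -> F),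
  [/\ #|L| = (#|F| ^ (2 ^ j))%N, {morph tr : x y / x + y}, forall u, exists z, tr z = u,
      forall z, tr (z ^+ #|F|) = tr z &
      forall (psi : F -> C) c, additive_char psi -> nontrivial_char psi -> c != 0 ->
        kloosterman (psi \o tr) (iota c) = doubling_seq #|F| (kloosterman psi c) j].
Proof.
move=> oddF; elim: j => [|j [K [iota [tr [cardK trD tr_surj tr_frob KE]]]]].
  exists F, idfun, id; split=> // [u|z]; [by exists u | exact: expf_card].
have oddK : odd #|K| by rewrite cardK oddX oddF orbT.
have [L [jota cardL]] := quadratic_ext_exists oddK.
exists L, (jota \o iota), (tr \o ext_trace jota).
split=> [|x y|u|z|psi c psi_add psi_nt c0] /=.
- by rewrite cardL cardK -expnM expnSr.
- by rewrite ext_traceD.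
- have [z <-] := tr_surj u; exists (jota (z / 2)); rewrite ext_trace_iota //.
  by congr tr; field; exact: natr2_neq0.
- rewrite -[RHS]tr_frob; congr tr; apply: (fmorph_inj jota).
  rewrite rmorphXn !iota_ext_trace // exprAC -exprDn_pchar //.
  have := pchar_nat_card L; rewrite cardL cardK !pnatX; case/orP => [/orP[]|] //.
  by rewrite expn_eq0.
have psi_tr_add : additive_char (psi \o tr).
  split; first by rewrite /= additive0 // psi_add.1.
  by move=> x y /=; rewrite trD psi_add.2.
have psi_tr_nt : nontrivial_char (psi \o tr).
  by have [a a1] := psi_nt; have [z za] := tr_surj a; exists z; rewrite /= za.
rewrite -(KE psi) // -cardK.
by rewrite -(kloosterman_ext oddK psi_tr_add psi_tr_nt jota cardL) ?fmorph_eq0.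
Qed.

(** In lowest terms, [b^2 = k f^2 D] forces [f] to be constant; then [b] divides both [D] and its
    derivative, so [b], and with it [D], is constant. *)
Lemma coprimep_deriv_not_square (L : fieldType) (D a d : {poly L}) (k : L) :
  coprimep D D^`() -> (1 < size D)%N -> k != 0 -> a ^+ 2 = k *: (d ^+ 2 * D) -> d = 0.
Proof.
move=> copD size_D k0 adE; apply/eqP; apply: contraTT size_D => d0.
pose g := gcdp a d; have g0 : g != 0 by rewrite gcdp_eq0 negb_and d0 orbT.
have [gD_a gD_d] : g %| a /\ g %| d by rewrite dvdp_gcdl dvdp_gcdr.
have cop : coprimep (a %/ g) (d %/ g) by rewrite coprimep_div_gcd // d0 orbT.
have {}adE : (a %/ g) ^+ 2 = k *: ((d %/ g) ^+ 2 * D).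
  apply: (mulfI (expf_neq0 2 g0)); rewrite -exprMn mulrC divpK // adE -scalerAr.
  by rewrite mulrA -exprMn [g * _]mulrC divpK.
move: (a %/ g) (d %/ g) cop adE => b f cop bE.
have f_size : size f = 1%N.
  apply/eqP; rewrite -coprimepp; apply: coprimep_dvdl (_ : coprimep f (b ^+ 2)).
    by rewrite bE dvdpZr // expr2 -mulrA dvdp_mulr.
  by rewrite coprimep_expr // coprimep_sym.
have [e e0 fE] : exists2 e, e != 0 & f = e%:P by apply/size_poly1P/eqP.
have b2E : b ^+ 2 = (k * e ^+ 2) *: D by rewrite bE fE -polyC_exp mul_polyC scalerA.
have ke0 : k * e ^+ 2 != 0 by rewrite mulf_neq0 ?expf_neq0.
have b_size : size b = 1%N.
  apply/eqP; rewrite -coprimepp.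
  have bD : b %| D by rewrite -(dvdpZr _ _ ke0) -b2E expr2 dvdp_mulr.
  apply: coprimep_dvdr bD _; apply: coprimep_dvdl copD.
  rewrite -(dvdpZr _ _ ke0) -derivZ -b2E expr2 derivM mulrC -mulr2n.
  by rewrite -mulr_natl dvdp_mull // dvdp_mulr.
rewrite -leqNgt -(size_scale _ ke0) -b2E; apply: leq_trans (size_exp_bound 2 (eq_leq b_size)) _.
by [].
Qed.

(* [D = (X^q - X)^2 - 4c] is the discriminant of [x^2 - (y^q - y) x + c], i.e. of the
   Artin-Schreier curve [y^q - y = x + c/x]. *)
Section ArtinSchreierCurve.
Variables (L : finFieldType) (q P : nat) (c : L).
Hypotheses (cardL : #|L| = (P ^ 2)%N) (oddL : odd #|L|) (c0 : c != 0).
Hypotheses (pq : [pchar L].-nat q) (q_gt1 : (1 < q)%N) (le_qP : (3 * q <= P)%N).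

Let D : {poly L} := ('X^q - 'X) ^+ 2 - (4 * c)%:P.

Lemma size_curve_poly : size D = (2 * q).+1.
Proof.
have size_u : size ('X^q - 'X : {poly L}) = q.+1.
  by rewrite size_polyDl ?size_polyXn // size_polyN size_polyX.
have size_u2 : size (('X^q - 'X : {poly L}) ^+ 2) = (2 * q).+1.
  have u_neq0 : 'X^q - 'X != 0 :> {poly L} by rewrite -size_poly_eq0 size_u.
  by rewrite -[LHS]prednK ?size_poly_gt0 ?expf_neq0 // size_exp size_u mulnC.
rewrite size_polyDl size_u2 // size_polyN; apply: leq_ltn_trans (size_polyC_leq1 _) _.
by rewrite ltnS muln_gt0 (ltnW q_gt1).
Qed.

(** The derivative of [X^q - X] is [-1], so that of [D] is [X^q - X] up to a unit, and [D] is
    [- 4 c] modulo that polynomial. *)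
Lemma coprimep_curve_poly : coprimep D D^`().
Proof.
have q0 : q%:R = 0 :> L.
  have /(pnatP _ (ltnW q_gt1))/(_ _ (pdiv_prime q_gt1) (pdiv_dvd q)) := pq.
  by move=> /dvdn_pcharf -/(_ q); rewrite pdiv_dvd => /esym/eqP.
have -> : D^`() = (- 2) *: ('X^q - 'X).
  have u' : ('X^q - 'X)^`() = -1 :> {poly L}.
    by rewrite derivB derivXn derivX -mulr_natl -polyC_natr q0 mul0r sub0r.
  rewrite derivB derivC subr0 expr2 derivM u' mulN1r mulrN1 -opprD -mulr2n.
  by rewrite scaleNr scaler_nat.
rewrite coprimepZr ?oppr_eq0 ?natr2_neq0 //.
have c4_neq0 : 4 * c != 0 by rewrite mulf_neq0 ?natr4_neq0.
apply/Bezout_eq1_coprimepP; exists (- ((4 * c)^-1)%:P, ((4 * c)^-1)%:P * ('X^q - 'X)) => /=.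
transitivity (((4 * c)^-1)%:P * (4 * c)%:P : {poly L}); first by rewrite /D; ring.
by rewrite -polyCM mulVf.
Qed.

(** The sum is [P^2 - 2 N - N0], with [N] nonsquare values and [N0 <= 2 q] roots of [D].
    [stepanov_bound] with [e = q] gives [2 N <= P^2 + 4 q P], and the remaining [2 q] is absorbed
    into [6 q P]. *)
Lemma sum_quad_char_curve (C : numDomainType) :
  - (6 * q * P)%:R <= \sum_y quad_char C ((y ^+ q - y) ^+ 2 - 4 * c).
Proof.
have q_gt0 := ltnW q_gt1.
have [h PE] : exists h, P = (2 * h - 1)%N.
  have oddP : odd P by move: oddL; rewrite cardL oddX.
  by exists P./2.+1; have := odd_double_half P; rewrite oddP -mul2n; lia.
have D0 : D.[0] != 0.
  by rewrite /D !hornerE expr0n eqn0Ngt q_gt0 /= subrr expr0n sub0r oppr_eq0 mulf_neq0 ?natr4_neq0.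
have DE y : D.[y] = (y ^+ q - y) ^+ 2 - 4 * c by rewrite /D !hornerE.
have D_sqf : forall (a d : {poly L}) (k : L), k != 0 -> a ^+ 2 = k *: (d ^+ 2 * D) -> d = 0.
  move=> a d k; apply: coprimep_deriv_not_square; first exact: coprimep_curve_poly.
  by rewrite size_curve_poly ltnS muln_gt0.
have lt_qh : (q.+1 < h)%N by lia.
have := @stepanov_bound L h q D; rewrite -PE => /(_ cardL size_curve_poly D0 q_gt0 lt_qh D_sqf).
set N := #|finset _|; rewrite cardL => bound.
pose N0 := #|[set y | root D y]|.
have D_neq0 : D != 0 by rewrite -size_poly_eq0 size_curve_poly.
have le_N0 : (N0 <= 2 * q)%N.
  have := @max_poly_roots L D (enum [set y | root D y]) D_neq0.
  rewrite enum_uniq -cardE size_curve_poly ltnS; apply=> //.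
  by apply/allP => y; rewrite mem_enum inE.
have cardR (p : pred L) : #|[set y | p y]|%:R = \sum_y (p y)%:R :> C.
  rewrite -sum1_card natr_sum big_mkcond; apply: eq_bigr => y _; rewrite inE.
  by case: (p y).
have sumE : \sum_y quad_char C ((y ^+ q - y) ^+ 2 - 4 * c) = (P ^ 2)%:R - (2 * N + N0)%:R.
  rewrite -cardL -sum1_card natrD natrM !cardR mulr_sumr -big_split natr_sum -sumrB.
  apply: eq_bigr => y _ /=; rewrite -DE /quad_char /root.
  case: eqP => [->|/eqP Dy0] /=.
    rewrite expr0n; have -> : (#|L|.-1./2 == 0%N) = false.
      apply/negbTE; rewrite -lt0n cardL; have : (3 ^ 2 <= P ^ 2)%N by rewrite leq_exp2r //; lia.
      by case: (P ^ 2)%N => [|[|[|n]]].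
    by rewrite [0 == -1]eq_sym oppr_eq0 oner_eq0 mulr0 add0r subrr.
  case: (expf_half_card oddL Dy0) => ->; rewrite eqxx.
    by rewrite eq_sym oppr1_eq1 // mulr0 addr0 subr0.
  by rewrite oppr1_eq1 // mulr1 addr0; ring.
rewrite sumE -subr_ge0 opprK addrAC -natrD subr_ge0 ler_nat.
have : (q <= q * P)%N by rewrite -{1}[q]muln1 leq_mul2l; lia.
lia.
Qed.

End ArtinSchreierCurve.

Lemma additive_char_comp (F : finFieldType) (L : finFieldType) (C : pzRingType)
    (psi : F -> C) (f : L -> F) :
  {morph f : x y / x + y} -> additive_char psi -> additive_char (psi \o f).
Proof.
move=> fD psi_add; split=> [|x y] /=; first by rewrite additive0 // psi_add.1.
by rewrite fD psi_add.2.
Qed.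

Lemma nontrivial_char_comp (F : finFieldType) (L : finFieldType) (C : pzRingType)
    (psi : F -> C) (f : L -> F) :
  (forall u, exists z, f z = u) -> nontrivial_char psi -> nontrivial_char (psi \o f).
Proof.
by move=> f_surj [a a1]; have [z za] := f_surj a; exists z; rewrite /= za.
Qed.

Section KloostermanSum.
Variables (F L : finFieldType) (iota : {rmorphism F -> L}) (tr : L -> F) (P : nat).
Variables (C : numClosedFieldType) (psi : F -> C) (c : F).
Let q := #|F|.
Hypotheses (oddL : odd #|L|) (cardL : #|L| = (P ^ 2)%N).
Hypotheses (pq : [pchar L].-nat q) (le_qP : (3 * q <= P)%N).
Hypotheses (trD : {morph tr : x y / x + y}) (tr_surj : forall u, exists z, tr z = u).
Hypothesis tr_frob : forall z, tr (z ^+ q) = tr z.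
Hypotheses (psi_add : additive_char psi) (psi_nt : nontrivial_char psi) (c0 : c != 0).

Let artin_schreier (y : L) := y ^+ q - y.

Lemma artin_schreierD : {morph artin_schreier : x y / x + y}.
Proof. by move=> x y; rewrite /artin_schreier exprDn_pchar // opprD addrACA. Qed.

Lemma card_artin_schreier_ker : #|[set y | artin_schreier y == 0]| = q.
Proof.
rewrite -[RHS](card_codom (fmorph_inj iota)); apply: eq_card => y; rewrite inE subr_eq0.
apply/eqP/codomP => [yq|[u ->]]; last by rewrite iota_expf_card.
by have [u <-] := fixed_in_iota iota yq; exists u.
Qed.

Lemma card_trace_ker : (#|[set z | tr z == 0%R]| * q = #|L|)%N.
Proof.
rewrite (card_additive trD) mulnC; congr (_ * _)%N; rewrite /q -cardsT; apply: eq_card => u.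
by rewrite !inE; apply/esym/imsetP; have [z <-] := tr_surj u; exists z.
Qed.

(** Additive Hilbert 90 by counting: the image lies in the kernel of [tr] by Frobenius invariance,
    and both have [#|L| / q] elements. *)
Lemma artin_schreier_image : artin_schreier @: setT = [set z | tr z == 0].
Proof.
apply/eqP; rewrite eqEcard; apply/andP; split.
  apply/subsetP => _ /imsetP[y _ ->]; rewrite inE /artin_schreier.
  rewrite -(inj_eq (addIr (tr y))) -trD subrK tr_frob add0r.
  by [].
have q_gt0 : (0 < q)%N := ltnW (finRing_gt1 F).
rewrite -(leq_pmul2r q_gt0) card_trace_ker (card_additive artin_schreierD).
by rewrite card_artin_schreier_ker.
Qed.

(** Summed over all [a], orthogonality keeps the [u] of trace [0] with weight [q], and each of them
    is [y^q - y] for exactly [q] values of [y]; this produces the sum over the curve. The term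
    [a = 0] is a sum of [quad_char] alone, equal to [-1]. *)
Lemma sum_kloosterman_ge :
  - (6 * q * P)%:R <= \sum_(a | a != 0) kloosterman (fun z => psi (a * tr z)) (iota c).
Proof.
have ic0 : iota c != 0 by rewrite fmorph_eq0.
pose eta (u : L) : C := quad_char C (u ^+ 2 - 4 * iota c).
have KE a : a != 0 ->
    kloosterman (fun z => psi (a * tr z)) (iota c) = \sum_u psi (a * tr u) * eta u.
  move=> a0; apply: kloosterman_quad_char => //.
    by apply: (additive_char_comp (f := fun z => a * tr z)) => // x y; rewrite trD mulrDr.
  apply: (nontrivial_char_comp (f := fun z => a * tr z)) => // u.
  by have [z za] := tr_surj (a^-1 * u); exists z; rewrite za mulrA mulfV // mul1r.
have -> : \sum_(a | a != 0) kloosterman (fun z => psi (a * tr z)) (iota c)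
    = \sum_a \sum_u psi (a * tr u) * eta u + 1.
  rewrite (eq_bigr _ (fun a a0 => KE a a0)) [in RHS](bigD1 0) //= addrAC.
  rewrite (eq_bigr eta) => [|u _]; last by rewrite mul0r psi_add.1 mul1r.
  by rewrite sum_quad_char_sqr_sub // addNr add0r.
rewrite exchange_big /=; have -> : \sum_u \sum_a psi (a * tr u) * eta u =
    \sum_y eta (artin_schreier y).
  rewrite (sum_additive artin_schreierD) card_artin_schreier_ker artin_schreier_image.
  rewrite [RHS]big_mkcond; apply: eq_bigr => u _; rewrite inE -big_distrl /=.
  by rewrite sum_additive_charM //; case: eqP; rewrite ?mul0r // mulr_natl.
apply: le_trans (_ : \sum_y eta (artin_schreier y) <= _); last by rewrite lerDl ler01.
exact: sum_quad_char_curve (finRing_gt1 F) _ _.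
Qed.

End KloostermanSum.

Lemma doubling_seq_le (R : realDomainType) (q : nat) (x : R) (j : nat) :
  doubling_seq q x j.+1 <= 2 * (q ^ (2 ^ j))%:R.
Proof. by rewrite /= lerBlDr lerDl sqr_ge0. Qed.

(** Relative to the square root of the field size, [- (2 + t)] goes to
    [2 - (2 + t)^2 <= - (2 + 4 t)]: the excess over [2] at least quadruples at each step. *)
Lemma doubling_seq_diverges (R : realFieldType) (q : nat) (x th : R) (j : nat) :
  0 <= th -> (4 + th) * q%:R <= x ^+ 2 ->
  doubling_seq q x j.+1 <= - (2 + 4 ^+ j * th) * (q ^ (2 ^ j))%:R.
Proof.
move=> th0 xth; elim: j => [|j IH].
  by rewrite /= expn0 expn1 expr0 mul1r; lra.
rewrite [doubling_seq _ _ _]/= -/(doubling_seq q x j.+1) expnS mulnC expnM natrX.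
set Q : R := (q ^ (2 ^ j))%:R in IH *; set y := doubling_seq q x j.+1 in IH *.
have Q0 : 0 <= Q by rewrite ler0n.
have t0 : 0 <= 4 ^+ j * th by rewrite mulr_ge0 ?exprn_ge0.
rewrite (exprS 4) -mulrA; set t := 4 ^+ j * th in IH t0 *.
have : ((2 + t) * Q) ^+ 2 <= y ^+ 2.
  rewrite -(sqrrN y) lerXn2r ?nnegrE ?mulr_ge0 ?addr_ge0 //.
    by rewrite oppr_ge0 (le_trans IH) // mulNr oppr_le0 mulr_ge0 ?addr_ge0.
  by move: IH; rewrite mulNr lerNr.
have : 0 <= t ^+ 2 * Q ^+ 2 by rewrite mulr_ge0 ?sqr_ge0.
nra.
Qed.

Lemma rmorph_doubling_seq (A B : comPzRingType) (f : {rmorphism A -> B}) (q : nat) (x : A)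
    (j : nat) :
  doubling_seq q (f x) j = f (doubling_seq q x j).
Proof.
by elim: j => //= j ->; rewrite rmorphB rmorphM rmorphXn !rmorph_nat.
Qed.

Section WeilBound.
Local Open Scope complex_scope.
Variables (R : realType) (F : finFieldType) (psi : F -> R[i]) (c : F).
Let q := #|F|.
Hypotheses (oddF : odd #|F|) (psi_add : additive_char psi) (psi_nt : nontrivial_char psi).
Hypothesis c0 : c != 0.

Let K (a : F) : R := complex.Re (kloosterman (fun x => psi (a * x)) c).

Lemma additive_char_scale a : additive_char (fun x => psi (a * x)).
Proof. by apply: (additive_char_comp (f := *%R a)) => // x y; rewrite mulrDr. Qed.

Lemma nontrivial_char_scale a : a != 0 -> nontrivial_char (fun x => psi (a * x)).
Proof.
move=> a0; apply: (nontrivial_char_comp (f := *%R a)) => // u.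
by exists (a^-1 * u); rewrite mulrA mulfV ?mul1r.
Qed.

Lemma kloosterman_Re a : kloosterman (fun x => psi (a * x)) c = (K a)%:C.
Proof.
by rewrite [RHS]RRe_real // kloosterman_real //; exact: additive_char_scale.
Qed.

(** Level [j + 1] has order [P^2] with [P = q^(2^j)]; [j > 0] and [q >= 3] provide [3 q <= P]. *)
Lemma sum_doubling_seq_ge j : (0 < j)%N ->
  - (6 * q * q ^ (2 ^ j))%:R <= \sum_(a | a != 0) doubling_seq q (K a) j.+1.
Proof.
move=> j_gt0; have q_gt1 := finRing_gt1 F.
have q_ge3 : (3 <= q)%N.
  by move: oddF q_gt1; rewrite -/q; case: q => [|[|[|]]].
have [L [iota [tr [cardL trD tr_surj tr_frob KE]]]] := kloosterman_tower R[i] j.+1 oddF.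
have oddL : odd #|L| by rewrite cardL oddX oddF orbT.
have pq : [pchar L].-nat q.
  by have := pchar_nat_card L; rewrite cardL pnatX expn_eq0 orbF.
have le_qP : (3 * q <= q ^ (2 ^ j))%N.
  apply: (@leq_trans (q ^ 2)); first by rewrite -mulnn leq_mul2r q_ge3 orbT.
  by rewrite leq_exp2l // -{1}[2%N]expn1 leq_exp2l.
have cardL2 : #|L| = ((q ^ (2 ^ j)) ^ 2)%N by rewrite cardL expnS mulnC expnM.
have := sum_kloosterman_ge iota oddL cardL2 pq le_qP trD tr_surj tr_frob psi_add psi_nt c0.
rewrite (eq_bigr (fun a => (doubling_seq q (K a) j.+1)%:C)); last first.
  move=> a a0; have := KE _ _ (additive_char_scale a) (nontrivial_char_scale a0) c0.
  rewrite /comp => ->; rewrite kloosterman_Re.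
  exact: (rmorph_doubling_seq (real_complex R)).
by rewrite -rmorph_sum -(rmorph_nat (real_complex R)) -rmorphN /= lecR.
Qed.

(* A Kloosterman sum larger than [2 sqrt q] would grow without bound, relative to the square root
   of the field size, along the tower of quadratic extensions. *)
Lemma kloosterman_bound : `|kloosterman psi c| ^+ 2 <= (4 * q)%:R.
Proof.
have KE : kloosterman psi c = (K 1)%:C.
  rewrite -kloosterman_Re; apply: eq_bigr => x _; by rewrite mul1r.
rewrite KE normc_def /= expr0n addr0 -rmorphXn /= sqr_sqrtr ?sqr_ge0 //.
rewrite -(rmorph_nat (real_complex R)) lecR leNgt natrM; apply/negP => K_big.
have q_gt0 : 0 < q%:R :> R by rewrite ltr0n ltnW // finRing_gt1.
pose th := K 1 ^+ 2 / q%:R - 4.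
have th0 : 0 < th by rewrite subr_gt0 ltr_pdivlMr.
have K_th : (4 + th) * q%:R <= K 1 ^+ 2 by rewrite addrC subrK divfK // gt_eqF.
(* [8 = 6 + 2]: the whole sum is at least [- 6 q Q] and the terms [a != 1] contribute at most
   [2 q Q], so an excess [4^j th > 8 q] in the term [a = 1] is contradictory. *)
pose j := (Num.bound (8 * q%:R / th)).+1.
have := sum_doubling_seq_ge (ltn0Sn _ : 0 < j)%N; rewrite leNgt => /negP; apply.
rewrite (bigD1 1) ?oner_eq0 //=; set Q : R := (q ^ (2 ^ j))%:R.
have Q0 : 0 < Q by rewrite ltr0n expn_gt0 ltnW // finRing_gt1.
have le1 := doubling_seq_diverges j (ltW th0) K_th; rewrite -/Q in le1.
have le2 : \sum_(a | (a != 0) && (a != 1)) doubling_seq q (K a) j.+1 <= 2 * q%:R * Q.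
  apply: le_trans (ler_sum _ (fun a _ => doubling_seq_le q (K a) j)) _.
  rewrite sumr_const -/Q -[leLHS]mulr_natr mulrAC ler_pM2r // ler_pM2l ?ltr0n // ler_nat.
  exact: max_card.
have big : 8 * q%:R < 4 ^+ j * th.
  rewrite -ltr_pdivrMr //; apply: lt_le_trans (archi_boundP _) _.
    by rewrite divr_ge0 ?mulr_ge0 ?ler0n // ltW.
  rewrite -natrX ler_nat; apply: (@leq_trans j) => //; apply: ltnW; exact: ltn_expl.
rewrite natrM -/Q natrM.
apply: le_lt_trans (lerD le1 le2) _.
rewrite -mulrDl -mulNr ltr_pM2r //; lra.
Qed.

End WeilBound.

(** * Gauss and Salié sums *)

Lemma unity_root_neq1_exists (C : closedFieldType) (p : nat) :
  (1 < p)%N -> [pchar C] =i pred0 -> exists2 z : C, z ^+ p = 1 & z != 1.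
Proof.
move=> p_gt1 charC; pose h : {poly C} := \poly_(i < p) 1.
have size_h : size h = p by rewrite size_poly_eq // oner_eq0.
have /closed_rootP[z] : size h != 1%N by rewrite size_h gtn_eqF.
rewrite /root horner_poly => /eqP hz; exists z.
  apply/eqP; rewrite -subr_eq0 subrX1; under eq_bigr do rewrite -[_ ^+ _]mul1r.
  by rewrite hz mulr0.
apply/eqP => z1; move: hz; rewrite z1; under eq_bigr do rewrite expr1n mulr1.
rewrite sumr_const card_ord => /eqP; apply/negP.
by have /pcharf0P -> := charC; rewrite -lt0n ltnW.
Qed.

(** A coordinate functional over the prime field takes the place of the trace; it is picked nonzero
    at [1] so that a multiple of [1] witnesses nontriviality. *)
Lemma additive_char_exists (C : numClosedFieldType) (F : finFieldType) :
  exists2 psi : F -> C, additive_char psi & nontrivial_char psi.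
Proof.
have [p p_pr pcharFp] := finPcharP F.
have [z zp z1] : exists2 z : C, z ^+ p = 1 & z != 1.
  by apply: unity_root_neq1_exists; [exact: prime_gt1|exact: pchar_num].
pose V : vectType 'F_p := pPrimeCharType pcharFp.
pose one : V := (1 : F).
have [i ti] : exists i, coord (vbasis {:V}) i one != 0.
  apply/existsP; apply: contraT => /existsPn no_i.
  have one0 : one = 0.
    rewrite (coord_vbasis (memvf one)) big1 // => i _.
    by have := no_i i; rewrite negbK => /eqP ->; rewrite scale0r.
  by have /eqP no := oner_neq0 F; case: no; exact: one0.
pose t (x : V) : 'F_p := coord (vbasis {:V}) i x.
exists (fun x : F => z ^+ (t x)).
  split=> [|x y]; first by rewrite /t linear0.
  have zp' : z ^+ (Zp_trunc (pdiv p)).+2 = 1 by rewrite Fp_cast.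
  rewrite /t (linearD (coord _ _)) -exprD /=; exact: expr_mod.
exists ((t one)^-1 *: one); apply/eqP.
have -> : t ((t one)^-1 *: one) = 1 by rewrite {1}/t linearZ /= mulVf.
by rewrite /= modn_small.
Qed.

Section GaussSum.
Variables (F : finFieldType) (C : numClosedFieldType) (psi : F -> C).
Let q := #|F|.
Hypotheses (oddF : odd #|F|) (psi_add : additive_char psi) (psi_nt : nontrivial_char psi).

Definition quadratic_gauss_sum (s : F) : C := \sum_x psi (s * x ^+ 2).

Definition gauss_sum : C := \sum_u quad_char C u * psi u.

Lemma sum_complete_square (s m : F) : s != 0 ->
  \sum_x psi (s * x ^+ 2 + m * x) = quadratic_gauss_sum s * psi (- (m ^+ 2 / (4 * s))).
Proof.
move=> s0; rewrite (reindex_inj (addIr (- (m / (2 * s))))) big_distrl /=.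
apply: eq_bigr => x _; rewrite -psi_add.2; congr psi; field.
by rewrite s0 natr4_neq0 // natr2_neq0.
Qed.

Lemma norm_quadratic_gauss_sum (s : F) : s != 0 -> `|quadratic_gauss_sum s| ^+ 2 = q%:R.
Proof.
move=> s0; rewrite normCK /quadratic_gauss_sum rmorph_sum big_distrlr /= exchange_big /=.
transitivity (\sum_h psi (s * h ^+ 2) * \sum_y psi (y * (2 * s * h))).
  rewrite (eq_bigr (fun y => \sum_h psi (s * h ^+ 2) * psi (y * (2 * s * h)))); last first.
    move=> y _; rewrite (reindex_inj (addIr y)) /=; apply: eq_bigr => h _.
    by rewrite conj_additive_char // -!psi_add.2; congr psi; ring.
  by rewrite exchange_big; apply: eq_bigr => h _; rewrite big_distrr.
rewrite (bigD1 0) //= [X in _ + X]big1 => [|h h0]; last first.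
  by rewrite sum_additive_charM // !mulf_eq0 (negPf s0) (negPf h0) (negPf (natr2_neq0 oddF)) mulr0.
by rewrite sum_additive_charM // mulr0 eqxx expr0n mulr0 psi_add.1 mul1r addr0.
Qed.

Lemma quad_charV (x : F) : quad_char C x^-1 = quad_char C x.
Proof.
have [->|x0] := eqVneq x 0; first by rewrite invr0.
have e0 : quad_char C x != 0 by rewrite -sqrf_eq0 quad_char_sqr_eq1 // oner_eq0.
apply: (mulfI e0); rewrite -quad_charM // mulfV // -expr2 quad_char_sqr_eq1 //.
by rewrite -(expr1n _ 2) quad_char_sqr ?oner_eq0.
Qed.

Lemma sum_quad_char_scale (b : F) :
  b != 0 -> \sum_u quad_char C u * psi (b * u) = quad_char C b * gauss_sum.
Proof.
move=> b0; rewrite (reindex_inj (mulfI (invr_neq0 b0))) big_distrr /=.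
by apply: eq_bigr => u _; rewrite quad_charM // quad_charV mulVKf // mulrA.
Qed.

Lemma quadratic_gauss_sumE (s : F) :
  s != 0 -> quadratic_gauss_sum s = quad_char C s * gauss_sum.
Proof.
move=> s0; rewrite -sum_quad_char_scale //.
apply: etrans (sum_fiber (fun x => x ^+ 2) predT (fun u => psi (s * u))) _.
transitivity (\sum_u psi (s * u) * (1 + quad_char C u)).
  by apply: eq_bigr => u _; rewrite -card_sqrt // mulr_natr.
under eq_bigr do rewrite mulrDr mulr1 [_ * quad_char _ _]mulrC [s * _]mulrC.
rewrite big_split /= sum_additive_charM // (negPf s0) add0r.
by apply: eq_bigr => u _; rewrite [u * s]mulrC.
Qed.

Lemma norm_quad_char (s : F) : s != 0 -> `|quad_char C s| = 1.
Proof.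
by move=> s0; apply/eqP; rewrite -sqrp_eq1 ?normr_ge0 // -normrX quad_char_sqr_eq1 ?normr1.
Qed.

Lemma norm_gauss_sum : `|gauss_sum| ^+ 2 = q%:R.
Proof.
rewrite -(norm_quadratic_gauss_sum (oner_neq0 F)) quadratic_gauss_sumE ?oner_neq0 //.
by rewrite normrM norm_quad_char ?oner_neq0 // mul1r.
Qed.

Definition salie (c : F) : C := \sum_(x | x != 0) quad_char C x * psi (x + c / x).

(* For [u = x + b^2/x] with [x] not in [{b, -b}], both [u - 2b] and [u + 2b] are [x] times a
   nonzero square. *)
Lemma salie_sqr (b : F) : b != 0 ->
  salie (b ^+ 2) = gauss_sum * (psi (2 * b) + psi (- (2 * b))).
Proof.
move=> b0; pose e := @quad_char F C.
pose g u := (e (u - 2 * b) + e (u + 2 * b)) * psi u.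
have two0 : 2 != 0 :> C by rewrite pnatr_eq0.
have e4 x : e (4 * x) = e x.
  rewrite /e quad_charM // (_ : 4 = 2 ^+ 2) ?quad_char_sqr ?natr2_neq0 ?mul1r //.
  by rewrite -natrX.
have gE : \sum_u g u = gauss_sum * (psi (2 * b) + psi (- (2 * b))).
  rewrite /g; under eq_bigr do rewrite mulrDl.
  rewrite big_split /= mulrDr; congr (_ + _).
    rewrite (reindex_inj (addIr (2 * b))) big_distrl /=; apply: eq_bigr => u _.
    by rewrite addrK psi_add.2 mulrA.
  rewrite (reindex_inj (addIr (- (2 * b)))) big_distrl /=; apply: eq_bigr => u _.
  by rewrite subrK psi_add.2 mulrA.
(* At [u = 2 b] and [u = - 2 b] one of the two characters in [g] vanishes, and [corr] is the
   resulting defect. The same defect arises at [x = b] and [x = - b] in [two_salie] with the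
   opposite sign, so the two cancel. *)
pose corr u : C := (u == 2 * b)%:R * (e b * psi (2 * b))
  + (u == - (2 * b))%:R * (e (- b) * psi (- (2 * b))).
have sum_corr : \sum_u corr u = e b * psi (2 * b) + e (- b) * psi (- (2 * b)).
  rewrite /corr big_split /= -!big_distrl /=; congr (_ + _).
    by rewrite (bigD1 (2 * b)) //= eqxx big1 ?addr0 ?mul1r // => u /negPf ->.
  by rewrite (bigD1 (- (2 * b))) //= eqxx big1 ?addr0 ?mul1r // => u /negPf ->.
have bNb : b != - b.
  by rewrite -addr_eq0 -mulr2n -mulr_natl mulf_neq0 ?natr2_neq0.
have b2N : (2 * b == - (2 * b)) = false.
  by rewrite -mulrN (inj_eq (mulfI (natr2_neq0 oddF))) (negPf bNb).
have e0 : e 0 = 0 by exact: quad_char0.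
have expand u : g u * (1 + e (u ^+ 2 - 4 * b ^+ 2)) = 2 * g u - corr u.
  have -> : u ^+ 2 - 4 * b ^+ 2 = (u - 2 * b) * (u + 2 * b) by ring.
  rewrite /e quad_charM // -/e /g /corr.
  have [->|u1] := eqVneq u (2 * b).
    rewrite b2N subrr e0.
    have -> : 2 * b + 2 * b = 4 * b by ring.
    by rewrite e4 /=; ring.
  have [->|u2] := eqVneq u (- (2 * b)).
    rewrite addNr e0.
    have -> : - (2 * b) - 2 * b = 4 * (- b) by ring.
    by rewrite e4 /=; ring.
  have A2 : e (u - 2 * b) ^+ 2 = 1 by rewrite /e quad_char_sqr_eq1 // subr_eq0.
  have B2 : e (u + 2 * b) ^+ 2 = 1 by rewrite /e quad_char_sqr_eq1 // addr_eq0.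
  transitivity ((e (u - 2 * b) + e (u + 2 * b) + e (u - 2 * b) ^+ 2 * e (u + 2 * b)
    + e (u + 2 * b) ^+ 2 * e (u - 2 * b)) * psi u); first by ring.
  by rewrite A2 B2 /=; ring.
have e_sqr x y : e (x ^+ 2 * y) = (x != 0)%:R * e y.
  rewrite /e quad_charM //; have [->|x0] := eqVneq x 0.
    by rewrite expr0n quad_char0.
  by rewrite quad_char_sqr.
have two_salie : 2 * salie (b ^+ 2) = \sum_(x | x != 0) g (x + b ^+ 2 / x)
    + (e b * psi (2 * b) + e (- b) * psi (- (2 * b))).
  have delta y : y != 0 -> \sum_(x | x != 0) (x == y)%:R * (e y * psi (2 * y)) = e y * psi (2 * y).
    move=> y0; rewrite (bigD1 y) //= eqxx mul1r big1 ?addr0 // => x /andP[_ /negPf ->].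
    by rewrite mul0r.
  rewrite -mulrN -(delta b b0) -(delta (- b)) ?oppr_eq0 // -!big_split big_distrr /=.
  apply: eq_bigr => x x0; rewrite /g.
  have -> : x + b ^+ 2 / x - 2 * b = (x - b) ^+ 2 * x^-1 by field.
  have -> : x + b ^+ 2 / x + 2 * b = (x + b) ^+ 2 * x^-1 by field.
  rewrite !e_sqr /e quad_charV -/e subr_eq0 addr_eq0.
  have [->|xb] := eqVneq x b.
    rewrite (negPf bNb) expr2 mulfK //; have -> : b + b = 2 * b by ring.
    by rewrite /=; ring.
  have [->|xNb] := eqVneq x (- b).
    have -> : - b + b ^+ 2 / - b = 2 * - b by field; rewrite ?oppr_eq0 b0.
    by rewrite /=; ring.
  by rewrite /=; ring.
apply: (mulfI two0); rewrite two_salie sum_add_div ?expf_neq0 //.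
rewrite (eq_bigr _ (fun u _ => expand u)) big_split /= sumrN sum_corr subrK.
by rewrite -big_distrr /= gE.
Qed.

(** The substitution [x -> c/x] preserves [x + c/x] and reverses the sign of the character. *)
Lemma salie_nonsquare (c : F) : c != 0 -> quad_char C c = -1 -> salie c = 0.
Proof.
move=> c0 ec; apply/eqP; rewrite -[_ == _](@mulrn_eq0 C _ 2) mulr2n addr_eq0; apply/eqP.
have f_inj : {on [pred x | x != 0], bijective (fun x => c / x)}.
  exists (fun x => c / x) => x x0; by rewrite /= invfM invrK mulrA mulfV // mul1r.
rewrite {1}/salie (reindex _ f_inj) -sumrN /=; apply: eq_big => [x|x].
  by rewrite mulf_eq0 invr_eq0 (negPf c0).
move=> x0; rewrite quad_charM // quad_charV ec mulN1r mulNr; congr (- (_ * psi _)).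
by rewrite invfM invrK addrC mulrA mulfV // mul1r.
Qed.

Lemma salie_bound (c : F) : `|salie c| ^+ 2 <= (4 * q)%:R.
Proof.
have [->|c0] := eqVneq c 0.
  have -> : salie 0 = gauss_sum.
    rewrite /gauss_sum [RHS](bigD1 0) //= quad_char0 mul0r add0r.
    by apply: eq_bigr => x _; rewrite mul0r addr0.
  by rewrite norm_gauss_sum ler_nat leq_pmull.
case: (expf_half_card oddF c0) => ch; last first.
  rewrite salie_nonsquare ?normr0 ?expr0n ?ler0n //.
  by rewrite /quad_char (negPf c0) ch oppr1_eq1.
have [b bc] := sqrt_exists oddF ch.
have b0 : b != 0 by rewrite -sqrf_eq0 bc.
have le2 : `|psi (2 * b) + psi (- (2 * b))| <= 2.
  by apply: le_trans (ler_normD _ _) _; rewrite !additive_char_norm.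
rewrite -bc salie_sqr // normrM exprMn norm_gauss_sum mulrC natrM.
rewrite ler_wpM2r ?ler0n //; have -> : 4%:R = 2 ^+ 2 :> C by rewrite -natrX.
by rewrite lerXn2r ?nnegrE ?normr_ge0.
Qed.

End GaussSum.

(** * The Fourier transform of a sphere *)

Section SphereKernel.
Local Open Scope complex_scope.
Variables (R : realType) (F : finFieldType) (psi : F -> R[i]).
Let q := #|F|.
Hypotheses (oddF : odd #|F|) (psi_add : additive_char psi) (psi_nt : nontrivial_char psi).

Lemma kloosterman_le (c : F) : `|kloosterman psi c| ^+ 2 <= (4 * q)%:R.
Proof.
have [->|c0] := eqVneq c 0; last exact: kloosterman_bound.
have -> : kloosterman psi 0 = -1.
  apply: (addrI (psi 0)); rewrite /kloosterman.
  under eq_bigr do rewrite mul0r addr0.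
  have := sum_additive_char psi_add psi_nt; rewrite (bigD1 0) //= => ->.
  by rewrite psi_add.1 subrr.
by rewrite normrN1 expr1n ler1n muln_gt0 /= ltnW // finRing_gt1.
Qed.

(** The [d]-th power of the Gauss sum at [s] carries [quad_char s ^ d], so the parity of [d] decides
    between a Salié and a Kloosterman sum. The substitution [s = - x/t], possible as [t != 0],
    brings the phase to the form [x + (N t/4)/x]. *)
Lemma sum_gauss_pow_le (d : nat) (t N : F) : t != 0 ->
  `|\sum_(s | s != 0) quadratic_gauss_sum psi s ^+ d * psi (- (s * t) - N / (4 * s))| ^+ 2
    <= (4 * q ^ d.+1)%:R.
Proof.
move=> t0; pose e := @quad_char F R[i].
pose T := \sum_(x | x != 0) e x ^+ d * psi (x + N * t / 4 / x).
have u0 : - t^-1 != 0 by rewrite oppr_eq0 invr_eq0.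
have -> : \sum_(s | s != 0) quadratic_gauss_sum psi s ^+ d * psi (- (s * t) - N / (4 * s))
    = (gauss_sum psi * e (- t^-1)) ^+ d * T.
  rewrite (reindex_inj (mulIf u0)) big_distrr /=; apply: eq_big => [x|x].
    by rewrite mulf_eq0 (negPf u0) orbF.
  move=> x0; rewrite quadratic_gauss_sumE // quad_charM // [RHS]mulrA -exprMn.
  have x0' : x != 0 by apply: contraNneq x0 => ->; rewrite mul0r.
  congr (_ ^+ _ * psi _); first by rewrite /e; ring.
  by field; rewrite x0' t0 natr4_neq0 //= oppr_eq0 oner_eq0.
have T_le : `|T| ^+ 2 <= (4 * q)%:R.
  rewrite /T; case/boolP: (odd d) => odd_d.
    rewrite (eq_bigr (fun x => e x * psi (x + N * t / 4 / x))); first exact: salie_bound.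
    move=> x x0; congr (_ * _); rewrite -(odd_double_half d) odd_d exprD -mul2n exprM.
    by rewrite /e quad_char_sqr_eq1 // expr1n mulr1.
  rewrite (eq_bigr (fun x => psi (x + N * t / 4 / x))); first exact: kloosterman_le.
  move=> x x0; rewrite -(odd_double_half d) (negPf odd_d) add0n -mul2n exprM.
  by rewrite /e quad_char_sqr_eq1 // expr1n mul1r.
rewrite normrM normrX normrM norm_quad_char // mulr1 exprMn exprAC norm_gauss_sum //.
rewrite expnSr mulnCA natrM natrX ler_wpM2l //.
by rewrite exprn_ge0 // ler0n.
Qed.

End SphereKernel.

Section Fourier.
Variables (F : finFieldType) (C : numClosedFieldType) (psi : F -> C) (d : nat).
Let q := #|F|.
Hypotheses (psi_add : additive_char psi) (psi_nt : nontrivial_char psi).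

Definition dot (m x : 'rV[F]_d) : F := \sum_i m 0 i * x 0 i.

Definition fourier (f : 'rV[F]_d -> C) (m : 'rV[F]_d) : C := \sum_x f x * psi (dot m x).

Lemma additive_char_sum (I : finType) (P : pred I) (a : I -> F) :
  psi (\sum_(i | P i) a i) = \prod_(i | P i) psi (a i).
Proof. exact: (big_morph psi psi_add.2 psi_add.1). Qed.

Lemma sum_prod_rV (f : 'I_d -> F -> C) :
  \sum_(x : 'rV[F]_d) \prod_i f i (x 0 i) = \prod_i \sum_a f i a.
Proof.
rewrite bigA_distr_bigA /= (reindex (fun g : {ffun 'I_d -> F} => \row_i g i)) /=.
  by apply: eq_bigr => g _; apply: eq_bigr => i _; rewrite mxE.
exists (fun x : 'rV_d => [ffun i => x 0 i]) => [g _|x _].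
  by apply/ffunP => i; rewrite ffunE mxE.
by apply/rowP => i; rewrite mxE ffunE.
Qed.

Lemma dotDr (m x y : 'rV[F]_d) : dot m (x + y) = dot m x + dot m y.
Proof. by rewrite -big_split; apply: eq_bigr => i _; rewrite mxE mulrDr. Qed.

Lemma dotNr (m x : 'rV[F]_d) : dot m (- x) = - dot m x.
Proof. by rewrite -sumrN; apply: eq_bigr => i _; rewrite mxE mulrN. Qed.

Lemma sum_char_dot (x : 'rV[F]_d) :
  \sum_m psi (dot m x) = if x == 0 then (q ^ d)%:R else 0.
Proof.
under eq_bigr do rewrite additive_char_sum.
rewrite (sum_prod_rV (fun i a => psi (a * x 0 i))).
under eq_bigr do rewrite sum_additive_charM //.
case: eqP => [->|/eqP x0].
  under eq_bigr do rewrite mxE eqxx.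
  by rewrite prodr_const card_ord natrX.
have [i xi] : exists i, x 0 i != 0.
  apply/existsP; apply: contraT => /existsPn no_i; case/eqP: x0.
  by apply/rowP => i; rewrite mxE; apply/eqP; have := no_i i; rewrite negbK.
by rewrite (bigD1 i) //= (negPf xi) mul0r.
Qed.

Lemma plancherel (f : 'rV[F]_d -> C) :
  \sum_m `|fourier f m| ^+ 2 = (q ^ d)%:R * \sum_x `|f x| ^+ 2.
Proof.
transitivity (\sum_x \sum_y f x * (f y)^* * \sum_m psi (dot m (x - y))).
  transitivity (\sum_m \sum_x \sum_y f x * (f y)^* * psi (dot m (x - y))).
    apply: eq_bigr => m _; rewrite normCK /fourier rmorph_sum big_distrlr /=.
    apply: eq_bigr => x _; apply: eq_bigr => y _.
    by rewrite rmorphM /= conj_additive_char // mulrACA -psi_add.2 dotDr dotNr.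
  rewrite exchange_big; apply: eq_bigr => x _; rewrite exchange_big.
  by apply: eq_bigr => y _; rewrite big_distrr.
rewrite big_distrr; apply: eq_bigr => x _ /=.
rewrite (bigD1 x) //= subrr sum_char_dot eqxx big1 => [|y yx].
  by rewrite addr0 normCK mulrC.
by rewrite sum_char_dot subr_eq0 eq_sym (negPf yx) mulr0.
Qed.

Lemma fourier_convolution (b f : 'rV[F]_d -> C) m :
  fourier (fun x => \sum_y b (x - y) * f y) m = fourier b m * fourier f m.
Proof.
rewrite /fourier big_distrr /=; under eq_bigr do rewrite big_distrl /=.
rewrite exchange_big /=; apply: eq_bigr => y _.
rewrite (reindex_inj (addIr y)) big_distrl /=; apply: eq_bigr => x _.
by rewrite addrK dotDr psi_add.2 mulrACA.
Qed.

Lemma convolution_norm_le (b f : 'rV[F]_d -> C) (B : C) :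
  (forall m, `|fourier b m| ^+ 2 <= B) ->
  \sum_x `|\sum_y b (x - y) * f y| ^+ 2 <= B * \sum_x `|f x| ^+ 2.
Proof.
move=> bB; have qd0 : 0 < (q ^ d)%:R :> C by rewrite ltr0n expn_gt0 ltnW // finRing_gt1.
rewrite -(ler_pM2l qd0) -plancherel mulrCA -plancherel big_distrr /=.
apply: ler_sum => m _; rewrite fourier_convolution normrM exprMn ler_wpM2r //.
by rewrite exprn_ge0.
Qed.

End Fourier.

Section SphereOperator.
Local Open Scope complex_scope.
Variables (R : realType) (F : finFieldType) (d : nat) (t : F).
Let q := #|F|.
Hypotheses (oddF : odd #|F|) (t0 : t != 0).

(* Subtracting [1/q] rather than the exact density of the sphere removes exactly the term [s = 0]
   from the expansion of the indicator of the sphere into additive characters. *)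
Definition sphere_kernel (A : unitRingType) (x : 'rV[F]_d) : A := (sqnorm x == t)%:R - q%:R^-1.

(** For each [s != 0] the sum over [x] factors into coordinates, and completing squares leaves
    powers of Gauss sums. With the term [s = 0] gone, the bound holds for every [m], including
    [m = 0]. *)
Lemma fourier_sphere_kernel (psi : F -> R[i]) (m : 'rV[F]_d) :
  additive_char psi -> nontrivial_char psi ->
  `|fourier psi (sphere_kernel R[i]) m| ^+ 2 <= (4 * q ^ d.+1)%:R / q%:R ^+ 2.
Proof.
move=> psi_add psi_nt; have q_gt0 : (0 < q)%N := ltnW (finRing_gt1 F).
have q0 : q%:R != 0 :> R[i] by rewrite pnatr_eq0 -lt0n.
have kernelE x : sphere_kernel R[i] x = q%:R^-1 * \sum_(s | s != 0) psi (s * (sqnorm x - t)).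
  rewrite /sphere_kernel; have := sum_additive_charM psi_add psi_nt (sqnorm x - t).
  rewrite (bigD1 0) //= mul0r psi_add.1 subr_eq0 => /(canRL (addKr 1)) ->.
  rewrite mulrDr mulrN1 addrC; congr (_ + _).
  by case: eqP => _; rewrite ?mulr0 // mulVf.
rewrite /fourier; have -> : \sum_x sphere_kernel R[i] x * psi (dot m x) = q%:R^-1 *
    \sum_(s | s != 0) quadratic_gauss_sum psi s ^+ d * psi (- (s * t) - sqnorm m / (4 * s)).
  under eq_bigr do rewrite kernelE -mulrA big_distrl /=.
  rewrite -big_distrr exchange_big /=; congr (_ * _); apply: eq_bigr => s s0.
  transitivity (psi (- (s * t)) * \sum_(x : 'rV[F]_d) \prod_i psi (s * x 0 i ^+ 2 + m 0 i * x 0 i)).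
    rewrite big_distrr; apply: eq_bigr => x _ /=.
    rewrite -additive_char_sum // -!psi_add.2; congr psi.
    by rewrite big_split /= -big_distrr /= /sqnorm /dot; ring.
  rewrite (sum_prod_rV (fun i a => psi (s * a ^+ 2 + m 0 i * a))).
  under eq_bigr do rewrite sum_complete_square //.
  rewrite big_split /= prodr_const card_ord mulrCA psi_add.2 -additive_char_sum //.
  by rewrite sumrN /sqnorm -big_distrl.
rewrite normrM exprMn normfV normr_nat exprVn mulrC ler_pM2r ?invr_gt0 ?exprn_gt0 ?ltr0n //.
exact: sum_gauss_pow_le.
Qed.

Lemma sphere_operator_le (f : 'rV[F]_d -> R) :
  \sum_x (\sum_y sphere_kernel R (x - y) * f y) ^+ 2
    <= (4 * q ^ d.+1)%:R / q%:R ^+ 2 * \sum_x f x ^+ 2.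
Proof.
have [psi psi_add psi_nt] := additive_char_exists R[i] F.
have := convolution_norm_le psi_add psi_nt (fun x => (f x)%:C)
  (fun m => fourier_sphere_kernel m psi_add psi_nt).
have normC (r : R) : `|r%:C| ^+ 2 = (r ^+ 2)%:C.
  by rewrite normc_def /= expr0n addr0 -rmorphXn /= sqr_sqrtr ?sqr_ge0.
have -> : \sum_x `|\sum_y sphere_kernel R[i] (x - y) * (f y)%:C| ^+ 2 =
    (\sum_x (\sum_y sphere_kernel R (x - y) * f y) ^+ 2)%:C.
  rewrite rmorph_sum; apply: eq_bigr => x _ /=; rewrite -normC rmorph_sum.
  congr (`|_| ^+ 2); apply: eq_bigr => y _; rewrite rmorphM /=; congr (_ * _).
  by rewrite /sphere_kernel rmorphB fmorphV !rmorph_nat.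
rewrite [X in _ <= _ * X](eq_bigr (fun x => (f x ^+ 2)%:C) (fun x _ => normC _)).
rewrite -rmorph_sum -(rmorph_nat (real_complex R)) -(rmorph_nat (real_complex R)).
by rewrite -rmorphXn -fmorphV -!rmorphM lecR.
Qed.

End SphereOperator.

(** * Closed walks for a rank-one perturbation *)

Section InnerProduct.
Variables (R : rcfType) (V : finType).
Implicit Types (f g h : V -> R) (k : V -> V -> R).

Definition inner f g : R := \sum_x f x * g x.
Definition l2norm f : R := Num.sqrt (inner f f).

Lemma innerC f g : inner f g = inner g f.
Proof. by apply: eq_bigr => x _; rewrite mulrC. Qed.

Lemma innerDr f g h : inner f (fun x => g x + h x) = inner f g + inner f h.
Proof. by rewrite -big_split; apply: eq_bigr => x _; rewrite mulrDr. Qed.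

Lemma innerZr a f g : inner f (fun x => a * g x) = a * inner f g.
Proof. by rewrite /inner big_distrr; apply: eq_bigr => x _; rewrite mulrCA. Qed.

Lemma inner_ge0 f : 0 <= inner f f.
Proof. by apply: sumr_ge0 => x _; rewrite -expr2 sqr_ge0. Qed.

Lemma l2norm_ge0 f : 0 <= l2norm f. Proof. exact: sqrtr_ge0. Qed.

Lemma sqr_l2norm f : l2norm f ^+ 2 = inner f f.
Proof. by rewrite sqr_sqrtr ?inner_ge0. Qed.

(** Lagrange's identity writes the defect as half a double sum of squares. *)
Lemma cauchy_schwarz f g : `|inner f g| <= l2norm f * l2norm g.
Proof.
rewrite -(@ler_pXn2r _ 2) ?nnegrE ?mulr_ge0 ?l2norm_ge0 //.
rewrite real_normK ?num_real // exprMn !sqr_l2norm -subr_ge0.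
suff -> : inner f f * inner g g - inner f g ^+ 2 =
    2^-1 * \sum_x \sum_y (f x * g y - f y * g x) ^+ 2.
  rewrite mulr_ge0 ?invr_ge0 ?ler0n //.
  by apply: sumr_ge0 => x _; apply: sumr_ge0 => y _; rewrite sqr_ge0.
have two0 : 2 != 0 :> R by rewrite pnatr_eq0.
apply: (mulfI two0); rewrite mulVKf // mulrBr mulr_natl mulr2n {2}[inner f f * _]mulrC.
rewrite expr2 /inner !big_distrlr /= big_distrr /= -big_split -sumrB /=.
apply: eq_bigr => x _; rewrite big_distrr -big_split -sumrB /=.
by apply: eq_bigr => y _; ring.
Qed.

Lemma l2normD f g : l2norm (fun x => f x + g x) <= l2norm f + l2norm g.
Proof.
rewrite -(@ler_pXn2r _ 2) ?nnegrE ?addr_ge0 ?l2norm_ge0 // sqr_l2norm.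
have -> : inner (fun x => f x + g x) (fun x => f x + g x) =
    inner f f + (inner f g + inner f g) + inner g g.
  by rewrite -!big_split; apply: eq_bigr => x _ /=; ring.
have := le_trans (ler_norm _) (cauchy_schwarz f g).
rewrite sqrrD !sqr_l2norm mulr2n; lra.
Qed.

Lemma l2normZ a f : l2norm (fun x => a * f x) = `|a| * l2norm f.
Proof.
rewrite /l2norm innerZr innerC innerZr mulrA -expr2 sqrtrM ?sqr_ge0 //.
by rewrite sqrtr_sqr.
Qed.

Definition kernel_op k f : V -> R := fun x => \sum_y k x y * f y.

Lemma inner_kernel_op k f g : (forall x y, k x y = k y x) ->
  inner (kernel_op k f) g = inner f (kernel_op k g).
Proof.
move=> k_sym; rewrite /inner /kernel_op; under eq_bigr do rewrite big_distrl /=.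
rewrite exchange_big; apply: eq_bigr => x _; rewrite big_distrr; apply: eq_bigr => y _ /=.
by rewrite k_sym; ring.
Qed.

Lemma inner_iter_kernel_op k f g n : (forall x y, k x y = k y x) ->
  inner (iter n (kernel_op k) f) g = inner f (iter n (kernel_op k) g).
Proof.
move=> k_sym; elim: n g => //= n IH g.
by rewrite inner_kernel_op // IH -iterSr.
Qed.

Definition delta (x : V) : V -> R := fun y => (y == x)%:R.

Lemma inner_delta x f : inner (delta x) f = f x.
Proof.
rewrite /inner /delta (bigD1 x) //= eqxx mul1r big1 ?addr0 // => y /negPf ->.
by rewrite mul0r.
Qed.

Lemma eq_kernel_op k f g : f =1 g -> kernel_op k f =1 kernel_op k g.
Proof. by move=> fg x; apply: eq_bigr => y _; rewrite fg. Qed.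

Lemma iter_kernel_opD k (a : R) f g n :
  iter n (kernel_op k) (fun x => a * f x + g x) =1
  (fun x => a * iter n (kernel_op k) f x + iter n (kernel_op k) g x).
Proof.
elim: n => //= n IH x; rewrite (eq_kernel_op _ IH) /kernel_op big_distrr -big_split /=.
by apply: eq_bigr => y _; ring.
Qed.

Lemma eq_iter_kernel_op k f g n : f =1 g -> iter n (kernel_op k) f =1 iter n (kernel_op k) g.
Proof. by move=> fg; elim: n => //= n IH; exact: eq_kernel_op. Qed.

Definition power_trace k n : R := \sum_x iter n (kernel_op k) (delta x) x.

Lemma eq_power_trace k k' n : k =2 k' -> power_trace k n = power_trace k' n.
Proof.
move=> kk'; apply: eq_bigr => x _; move: {2 4}x => y; elim: n y => //= n IH y.
by apply: eq_bigr => z _; rewrite kk' IH.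
Qed.

Variables (b : V -> V -> R) (lam : R).
Hypotheses (b_sym : forall x y, b x y = b y x) (lam_ge0 : 0 <= lam).
Hypothesis b_bound : forall f, l2norm (kernel_op b f) <= lam * l2norm f.

Lemma l2norm_iter_le f n : l2norm (iter n (kernel_op b) f) <= lam ^+ n * l2norm f.
Proof.
elim: n => [|n IH]; first by rewrite expr0 mul1r.
by apply: le_trans (b_bound _) _; rewrite exprS -mulrA ler_wpM2l.
Qed.

(** Written as [<B d_x, B^n (B d_x)>] with [d_x = delta x], the diagonal entry costs the operator
    norm only [n] times; the two outer factors sum over [x] to the Hilbert-Schmidt norm, which
    avoids a factor equal to the dimension. *)
Lemma power_trace_le n :
  `|power_trace b n.+2| <= lam ^+ n * \sum_x \sum_y b x y ^+ 2.
Proof.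
apply: le_trans (ler_norm_sum _ _ _) _; rewrite big_distrr /=; apply: ler_sum => x _.
rewrite -/(iter n.+2 (kernel_op b) (delta x)) -inner_delta iterSr /= -inner_kernel_op //.
have bx : inner (kernel_op b (delta x)) (kernel_op b (delta x)) = \sum_y b x y ^+ 2.
  apply: eq_bigr => y _; rewrite -expr2; congr (_ ^+ 2).
  by rewrite b_sym -(inner_delta x (b y)) innerC.
apply: le_trans (cauchy_schwarz _ _) _.
apply: le_trans (ler_wpM2l (l2norm_ge0 _) (l2norm_iter_le _ _)) _.
by rewrite mulrCA -expr2 sqr_l2norm bx.
Qed.

Variables (E : {set V}) (rho : R).
Hypothesis rho_ge0 : 0 <= rho.
Let ind : V -> R := fun x => (x \in E)%:R.
Let a x y : R := rho * (ind x * ind y) + b x y.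
Let M := rho * #|E|%:R.
Let Lam := M + lam.

Lemma inner_indicator : inner ind ind = #|E|%:R.
Proof.
rewrite -sum1_card natr_sum big_mkcond; apply: eq_bigr => x _ /=; rewrite /ind.
by case: (x \in E); rewrite ?mulr1 ?mulr0.
Qed.

Lemma l2norm_indicator : l2norm ind * l2norm ind = #|E|%:R.
Proof. by rewrite -expr2 sqr_l2norm inner_indicator. Qed.

Let a_sym x y : a x y = a y x.
Proof. by rewrite /a b_sym [ind x * _]mulrC. Qed.

Lemma kernel_op_rank1_add f :
  kernel_op a f =1 (fun x => (rho * inner ind f) * ind x + kernel_op b f x).
Proof.
move=> x; rewrite /kernel_op /a; under eq_bigr do rewrite mulrDl.
rewrite big_split; congr (_ + _); rewrite /inner /= big_distrr big_distrl /=.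
by apply: eq_bigr => y _; ring.
Qed.

Let M_ge0 : 0 <= M. Proof. by rewrite mulr_ge0 ?ler0n. Qed.

Let Lam_ge0 : 0 <= Lam. Proof. by rewrite addr_ge0 ?M_ge0. Qed.

Lemma l2norm_rank1_add_le f : l2norm (kernel_op a f) <= Lam * l2norm f.
Proof.
have -> : l2norm (kernel_op a f) =
    l2norm (fun x => (rho * inner ind f) * ind x + kernel_op b f x).
  by congr Num.sqrt; apply: eq_bigr => x _; rewrite kernel_op_rank1_add.
apply: le_trans (l2normD _ _) _; rewrite mulrDl lerD // l2normZ normrM ger0_norm //.
rewrite /M -l2norm_indicator -!mulrA ler_wpM2l // mulrC ler_wpM2l ?l2norm_ge0 //.
exact: cauchy_schwarz.
Qed.

Lemma l2norm_iter_rank1_add_le f n : l2norm (iter n (kernel_op a) f) <= Lam ^+ n * l2norm f.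
Proof.
elim: n => [|n IH]; first by rewrite expr0 mul1r.
by apply: le_trans (l2norm_rank1_add_le _) _; rewrite exprS -mulrA ler_wpM2l ?Lam_ge0.
Qed.

Lemma inner_iter_indicator_le l i :
  rho * `|inner (iter l (kernel_op b) ind) (iter i (kernel_op a) ind)|
    <= M * (lam ^+ l * Lam ^+ i).
Proof.
rewrite /M -mulrA ler_wpM2l //; apply: le_trans (cauchy_schwarz _ _) _.
apply: le_trans (ler_pM (l2norm_ge0 _) (l2norm_ge0 _) (l2norm_iter_le _ _) _) _.
  exact: l2norm_iter_rank1_add_le.
by rewrite mulrACA l2norm_indicator mulrC.
Qed.

(* The trace of [B^l A^i], which interpolates between the traces of [A^n] and [B^n]. *)
Let mixed_trace l i := \sum_x iter l (kernel_op b) (iter i (kernel_op a) (delta x)) x.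

Lemma mixed_traceS l i :
  mixed_trace l i.+1 = mixed_trace l.+1 i
    + rho * inner (iter l (kernel_op b) ind) (iter i (kernel_op a) ind).
Proof.
rewrite /inner big_distrr -big_split; apply: eq_bigr => x _ /=.
rewrite (eq_iter_kernel_op b l (kernel_op_rank1_add _)) iter_kernel_opD -!iterSr addrC.
rewrite -(inner_iter_kernel_op _ _ _ a_sym) innerC inner_delta.
by congr (_ + _); ring.
Qed.

Lemma power_traceB n : power_trace a n = power_trace b n +
  \sum_(l < n) rho * inner (iter l (kernel_op b) ind) (iter (n - l.+1) (kernel_op a) ind).
Proof.
suff step m : (m <= n)%N -> power_trace a n = mixed_trace m (n - m) +
    \sum_(l < m) rho * inner (iter l (kernel_op b) ind) (iter (n - l.+1) (kernel_op a) ind).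
  by rewrite (step n) // subnn.
elim: m => [|m IH] le_mn; first by rewrite big_ord0 addr0 subn0.
rewrite (IH (ltnW le_mn)) -(subnSK le_mn) mixed_traceS big_ord_recr /= -addrA.
by rewrite [_ + \sum_(_ < _) _]addrC.
Qed.

(** By self-adjointness [<1_E, A^(i+1) 1_E> = M <1_E, A^i 1_E> + <B 1_E, A^i 1_E>]: each step
    multiplies by [M] and adds an error with one factor [lam]. *)
Lemma walk_count_le i :
  `|rho * inner ind (iter i (kernel_op a) ind) - M ^+ i.+1| <= i%:R * (lam * Lam ^+ i).
Proof.
elim: i => [|i IH]; first by rewrite /= inner_indicator expr1 subrr normr0 mul0r.
set s := inner ind (iter i (kernel_op a) ind) in IH *.
have -> : inner ind (iter i.+1 (kernel_op a) ind) =
    M * s + inner (kernel_op b ind) (iter i (kernel_op a) ind).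
  transitivity (inner ind (fun x => (rho * s) * ind x + kernel_op b (iter i (kernel_op a) ind) x)).
    by apply: eq_bigr => x _ /=; rewrite kernel_op_rank1_add.
  by rewrite innerDr innerZr inner_indicator inner_kernel_op // /M; congr (_ + _); ring.
have := inner_iter_indicator_le 1 i; rewrite /= expr1.
set r := inner _ _ => r_le.
have -> : rho * (M * s + r) - M ^+ i.+2 = M * (rho * s - M ^+ i.+1) + rho * r.
  by rewrite [M ^+ i.+2]exprS; ring.
apply: le_trans (ler_normD _ _) _.
rewrite (normrM M) (ger0_norm M_ge0) (normrM rho) (ger0_norm rho_ge0).
have M_le : M <= Lam by rewrite lerDl.
have X0 : 0 <= lam * Lam ^+ i by rewrite mulr_ge0 ?exprn_ge0 ?Lam_ge0.
apply: le_trans (lerD (ler_wpM2l M_ge0 IH) r_le) _.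
rewrite exprS [lam * (Lam * _)]mulrCA -natr1.
have -> : M * (i%:R * (lam * Lam ^+ i)) + M * (lam * Lam ^+ i) =
    M * ((i%:R + 1) * (lam * Lam ^+ i)).
  by ring.
by rewrite [leRHS]mulrCA ler_wpM2r // mulr_ge0 // natr1 ler0n.
Qed.

(** The term [l = 0] of the telescoped sum is [M^(n+2)] up to [n + 1] errors of size
    [lam Lam^(n+1)]; each of the [n + 1] terms with [l >= 1] already contains a factor [lam]. Hence
    [2 (n + 1)]. *)
Lemma power_trace_estimate n :
  `|power_trace a n.+2 - M ^+ n.+2| <=
    lam ^+ n * \sum_x \sum_y b x y ^+ 2 + (2 * n.+1)%:R * (lam * Lam ^+ n.+1).
Proof.
rewrite power_traceB big_ord_recl subSS subn0 [iter (nat_of_ord ord0) _ _]/=.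
set X := _ * inner ind _; set Y := \sum_(l < n.+1) _.
have -> : power_trace b n.+2 + (X + Y) - M ^+ n.+2 = power_trace b n.+2 + ((X - M ^+ n.+2) + Y).
  by ring.
apply: le_trans (ler_normD _ _) _; rewrite lerD ?power_trace_le //.
apply: le_trans (ler_normD _ _) _; rewrite mul2n -addnn natrD mulrDl lerD //.
  exact: walk_count_le.
apply: le_trans (ler_norm_sum _ _ _) _.
have -> : n.+1%:R * (lam * Lam ^+ n.+1) = \sum_(l < n.+1) lam * Lam ^+ n.+1.
  by rewrite sumr_const card_ord mulr_natl.
apply: ler_sum => l _; rewrite normrM ger0_norm //; apply: le_trans (inner_iter_indicator_le _ _) _.
have M_le : M <= Lam by rewrite lerDl.
have lam_le : lam <= Lam by rewrite lerDr M_ge0.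
rewrite lift0; set r := (n.+2 - _)%N.
rewrite [X in lam * Lam ^+ X](_ : _ = (l + r).+1); last by have := ltn_ord l; rewrite /r; lia.
suff core (m u : R) : 0 <= m -> m <= u -> lam <= u ->
    m * (lam ^+ l.+1 * u ^+ r) <= lam * u ^+ (l + r).+1.
  exact: core M_ge0 M_le lam_le.
move=> m0 mu lu; have u0 : 0 <= u := le_trans m0 mu.
rewrite !exprS exprD mulrA [m * (_ * _)]mulrCA -!mulrA ler_wpM2l //.
apply: ler_pM => //; rewrite ?mulr_ge0 ?exprn_ge0 //.
by rewrite ler_wpM2r ?exprn_ge0 // lerXn2r ?nnegrE.
Qed.

End InnerProduct.

(** * Cycles in the distance graph *)

Lemma sum_tuple_cons (R : nmodType) (V : finType) (n : nat) (f : V -> n.-tuple V -> R) :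
  \sum_(c : n.+1.-tuple V) f (thead c) (behead_tuple c) = \sum_x \sum_(p : n.-tuple V) f x p.
Proof.
rewrite pair_big /= (reindex (fun xp : V * n.-tuple V => cons_tuple xp.1 xp.2)) /=.
  by apply: eq_bigr => -[x p] _ /=; rewrite theadE; congr f; apply: val_inj.
exists (fun c : n.+1.-tuple V => (thead c, behead_tuple c)) => [[x p] _|c _] /=.
  by rewrite theadE; congr (_, _); apply: val_inj.
by rewrite [in RHS](tuple_eta c); apply: val_inj.
Qed.

Lemma iter_kernel_op_path (R : rcfType) (V : finType) (e : rel V) (f : V -> R) n x :
  iter n (kernel_op (fun x y => (e x y)%:R)) f x =
  \sum_(p : n.-tuple V) (path e x p)%:R * f (last x p).
Proof.
elim: n x => [|n IH] x.
  rewrite (bigD1 [tuple]) //= big1 ?addr0 ?mul1r // => p /eqP[].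
  exact: tuple0.
rewrite iterS /kernel_op; under eq_bigr do rewrite IH big_distrr /=.
rewrite -(sum_tuple_cons (fun y (p : n.-tuple V) => _)) /=; apply: eq_bigr => c _.
by rewrite [in RHS](tuple_eta c) /= mulrA -natrM mulnb.
Qed.

Lemma power_trace_cycle (R : rcfType) (V : finType) (e : rel V) n :
  power_trace (fun x y => (e x y)%:R : R) n.+1 = #|[set c : n.+1.-tuple V | cycle e c]|%:R.
Proof.
rewrite /power_trace; under eq_bigr do rewrite iter_kernel_op_path.
rewrite exchange_big -sum1_card natr_sum [RHS]big_mkcond; apply: eq_bigr => c _ /=.
(* [c] is nonempty, so its last entry does not depend on the start [x]; [delta] then leaves only the
   start [x = z], for which the path closes up into the cycle [c]. *)
set z := last (thead c) c; have last_c x : last x c = z by rewrite /z; case: c {z} => -[].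
rewrite inE (cycle_path (thead c)) -/z (bigD1 z) //= big1 => [|x /negPf xz].
  by rewrite addr0 last_c /delta eqxx mulr1; case: path.
by rewrite last_c /delta eq_sym xz mulr0.
Qed.

Lemma cycle_restrict (V : eqType) (e : rel V) (P : pred V) (c : seq V) :
  cycle [rel x y | [&& P x, P y & e x y]] c = all P c && cycle e c.
Proof.
case: (boolP (all P c)) => [Pc|/allPn[x xc Px]] /=.
  apply: (@eq_in_cycle _ P) => // x y Px Py /=.
  by rewrite (Px : P x) (Py : P y).
apply/negP => /(next_cycle)/(_ xc) /=; by rewrite (negPf Px).
Qed.

Section CycleCount.
Variables (R : realType) (F : finFieldType) (d : nat) (t : F) (E : {set 'rV[F]_d}).
Hypotheses (oddF : odd #|F|) (t0 : t != 0).
Let q : R := #|F|%:R.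
Let lam : R := Num.sqrt ((4 * #|F| ^ d.+1)%:R / q ^+ 2).
Let M : R := #|E|%:R / q.
Let ind (x : 'rV[F]_d) : R := (x \in E)%:R.
Let b (x y : 'rV[F]_d) : R := ind x * ind y * sphere_kernel t R (x - y).

Lemma sqnormN (x : 'rV[F]_d) : sqnorm (- x) = sqnorm x.
Proof. by apply: eq_bigr => i _; rewrite mxE sqrrN. Qed.

Let q_gt0 : 0 < q. Proof. by rewrite ltr0n ltnW // finRing_gt1. Qed.

Lemma restricted_kernel_sym x y : b x y = b y x.
Proof. by rewrite /b [ind x * _]mulrC /sphere_kernel -(sqnormN (x - y)) opprB. Qed.

Let ind_sqr_le (r : R) x : (ind x * r) ^+ 2 <= r ^+ 2.
Proof. by rewrite /ind; case: (x \in E); rewrite ?mul1r // mul0r expr0n sqr_ge0. Qed.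

(** Multiplying by the indicator of [E] before and after does not increase norms, so the bound on
    the whole space is inherited. *)
Lemma l2norm_restricted_kernel_le f : l2norm (kernel_op b f) <= lam * l2norm f.
Proof.
have lam2 : 0 <= (4 * #|F| ^ d.+1)%:R / q ^+ 2 by rewrite divr_ge0 ?sqr_ge0.
rewrite -sqrtrM // ler_sqrt ?(mulr_ge0 lam2) ?inner_ge0 //.
apply: le_trans (_ : \sum_x (\sum_y sphere_kernel t R (x - y) * (ind y * f y)) ^+ 2 <= _).
  apply: ler_sum => x _; rewrite -expr2; apply: le_trans (ind_sqr_le _ x).
  rewrite le_eqVlt; apply/orP; left; apply/eqP; congr (_ ^+ 2).
  by rewrite /kernel_op big_distrr; apply: eq_bigr => y _; rewrite /b /=; ring.
apply: le_trans (sphere_operator_le oddF t0 _) _.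
by rewrite ler_wpM2l //; apply: ler_sum => x _; rewrite -expr2 ind_sqr_le.
Qed.

Lemma restricted_adjacencyE x y : q^-1 * (ind x * ind y) + b x y =
  ([&& x \in E, y \in E & dist_adj t x y])%:R.
Proof.
rewrite /b /sphere_kernel /ind /= -/q.
by case: (x \in E); case: (y \in E); rewrite /= ?mul0r ?mulr0 ?mul0r ?addr0 //; ring.
Qed.

(** For pairs in [E], [(adj - 1/q)^2 <= adj + 1/q^2]. The adjacency part counts edges,
    [<1_E, A 1_E> = M |E| + <1_E, B 1_E>], whose second term is at most [lam |E|]; the constant part
    gives [M^2]. *)
Lemma sum_sqr_restricted_kernel_le :
  \sum_x \sum_y b x y ^+ 2 <= M * #|E|%:R + lam * #|E|%:R + M ^+ 2.
Proof.
have qV0 : 0 <= q^-1 by rewrite invr_ge0 ltW // q_gt0.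
apply: le_trans (_ : inner ind (kernel_op (fun x y => q^-1 * (ind x * ind y) + b x y) ind)
   + \sum_x \sum_y q^-1 ^+ 2 * (ind x * ind y) <= _).
  rewrite /inner /kernel_op -big_split; apply: ler_sum => x _ /=.
  rewrite big_distrr -big_split; apply: ler_sum => y _ /=.
  rewrite restricted_adjacencyE /b /sphere_kernel /ind /= -/q.
  case: (x \in E); case: (y \in E);
    rewrite /= ?mul0r ?mulr0 ?expr0n ?addr0 // ?mulr1 ?mul1r ?mul0r //; last by rewrite expr0n.
  by rewrite /dist_adj /=; case: eqP => _ /=; nra.
rewrite lerD //.
  have -> : inner ind (kernel_op (fun x y => q^-1 * (ind x * ind y) + b x y) ind) =
      inner ind (fun x => (q^-1 * inner ind ind) * ind x + kernel_op b ind x).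
    by apply: eq_bigr => x _; rewrite kernel_op_rank1_add.
  rewrite innerDr innerZr inner_indicator lerD //; first by rewrite /M [_ / q]mulrC.
  apply: le_trans (ler_norm _) _; apply: le_trans (cauchy_schwarz _ _) _.
  apply: le_trans (ler_wpM2l (l2norm_ge0 _) (l2norm_restricted_kernel_le _)) _.
  by rewrite mulrCA l2norm_indicator.
have -> : \sum_x \sum_y q^-1 ^+ 2 * (ind x * ind y) = q^-1 ^+ 2 * ((\sum_x ind x) * (\sum_y ind y)).
  rewrite big_distrlr big_distrr; apply: eq_bigr => x _ /=; by rewrite big_distrr.
have -> : \sum_x ind x = #|E|%:R.
  rewrite -sum1_card natr_sum [RHS]big_mkcond; apply: eq_bigr => x _.
  by rewrite /ind; case: (x \in E).
by rewrite /M le_eqVlt; apply/orP; left; apply/eqP; ring.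
Qed.

Lemma cycle_count_le n : `|(cycle_count t E n.+2)%:R - M ^+ n.+2| <=
  lam ^+ n * (M * #|E|%:R + lam * #|E|%:R + M ^+ 2)
    + (2 * n.+1)%:R * (lam * (M + lam) ^+ n.+1).
Proof.
have lam0 : 0 <= lam := sqrtr_ge0 _.
have qV0 : 0 <= q^-1 by rewrite invr_ge0 ltW // q_gt0.
have -> : (cycle_count t E n.+2)%:R = power_trace (fun x y => q^-1 * (ind x * ind y) + b x y) n.+2.
  rewrite /cycle_count /dist_cycles.
  pose e := [rel x y | [&& x \in E, y \in E & dist_adj t x y]].
  transitivity (power_trace (fun x y => (e x y)%:R : R) n.+2).
    rewrite power_trace_cycle; congr _%:R; apply: eq_card => c; rewrite !inE.
    exact: esym (cycle_restrict _ (fun x => x \in E) c).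
  by apply: eq_power_trace => x y; rewrite restricted_adjacencyE.
have := power_trace_estimate restricted_kernel_sym lam0 l2norm_restricted_kernel_le E qV0 n.
rewrite -/ind [q^-1 * #|E|%:R]mulrC -/M.
move=> /le_trans; apply; rewrite lerD // ler_wpM2l ?exprn_ge0 //.
exact: sum_sqr_restricted_kernel_le.
Qed.

End CycleCount.

(** * Choice of parameters and the threshold on [|E|] *)

Lemma error_terms_le (R : realFieldType) (m : nat) (q M eps T : R) :
  0 <= M -> 1 <= q -> 0 <= eps -> eps <= 1 -> eps ^+ m * q <= 2 ^+ m * T ->
  (2 * m.+1)%:R * 2 ^+ m.+1 * eps <= T ->
  (eps * M) ^+ m * (M * (q * M) + eps * M * (q * M) + M ^+ 2)
    + (2 * m.+1)%:R * (eps * M * (M + eps * M) ^+ m.+1)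
    <= (3 * 2 ^+ m + 1) * M ^+ m.+2 * T.
Proof.
move=> M0 q1 e0 e1 em eT; have Mm0 : 0 <= M ^+ m.+2 by rewrite exprn_ge0.
have -> : (3 * 2 ^+ m + 1) * M ^+ m.+2 * T = M ^+ m.+2 * (3 * (2 ^+ m * T)) + M ^+ m.+2 * T.
  by ring.
apply: lerD.
  have -> : (eps * M) ^+ m * (M * (q * M) + eps * M * (q * M) + M ^+ 2) =
      M ^+ m.+2 * (eps ^+ m * (q + eps * q + 1)).
    by rewrite exprMn -(addn2 m) exprD; ring.
  (* [q + eps q + 1 <= 3 q]; this is the [3] in the constant. *)
  rewrite ler_wpM2l //; apply: le_trans (_ : 3 * (eps ^+ m * q) <= _); last by rewrite ler_wpM2l.
  by rewrite mulrCA ler_wpM2l ?exprn_ge0 //; nra.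
have -> : (2 * m.+1)%:R * (eps * M * (M + eps * M) ^+ m.+1) =
    M ^+ m.+2 * ((2 * m.+1)%:R * (1 + eps) ^+ m.+1 * eps).
  have -> : M + eps * M = (1 + eps) * M by ring.
  by rewrite exprMn [M ^+ m.+2]exprS; ring.
rewrite ler_wpM2l //; apply: le_trans eT; rewrite ler_wpM2r // ler_wpM2l ?ler0n //.
by rewrite lerXn2r ?nnegrE ?addr_ge0 //; lra.
Qed.

(** Here [m = n - 2]. The threshold amounts to [lam / M <= 2 U], where [U^m q = T] is the saving.
    The last hypothesis makes [U] smaller than [T] by the constant of the [O(lam ..)] term; this is
    where [q] must be large. *)
Lemma cycle_count_asymp (R : realType) (F : finFieldType) (d m : nat) (t : F)
    (E : {set 'rV[F]_d}) (delta : R) :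
  odd #|F| -> t != 0 -> (0 < m)%N -> 0 <= delta ->
  let q : R := #|F|%:R in
  q `^ ((d%:R + 1 + 2 / m%:R + delta) / 2) <= #|E|%:R ->
  (4 * m.+1)%:R * 2 ^+ m.+1 <= q `^ (1 / m%:R - (m%:R - 1) * delta / 2) ->
  `|(cycle_count t E m.+2)%:R - (#|E|%:R / q) ^+ m.+2|
    <= (3 * 2 ^+ m + 1) * (#|E|%:R / q) ^+ m.+2 * q `^ (- (m%:R * delta / 2)).
Proof.
move=> oddF t0 m_gt0 delta0 q N_ge q_big.
have q_gt1 : 1 < q by rewrite ltr1n finRing_gt1.
have q_gt0 : 0 < q := lt_trans ltr01 q_gt1.
have q0 : q != 0 by rewrite gt_eqF.
have m0 : 0 < m%:R :> R by rewrite ltr0n.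
have powqD x y : q `^ (x + y) = q `^ x * q `^ y by rewrite powRD // q0 implybT.
have powq0 x : 0 < q `^ x by rewrite powR_gt0.
set N : R := #|E|%:R in N_ge *; set M := N / q.
set T := q `^ (- _).
pose U := q `^ (- (1 / m%:R + delta / 2)).
have N_gt0 : 0 < N := lt_le_trans (powq0 _) N_ge.
have M_gt0 : 0 < M by rewrite divr_gt0.
apply: le_trans (cycle_count_le R E oddF t0 m) _; rewrite -/q -/N -/M.
set lam := Num.sqrt _.
have lam_le : lam <= 2 * U * M.
  have -> : lam = 2 * q `^ ((d%:R - 1) / 2).
    have -> : lam = Num.sqrt ((2 * q `^ ((d%:R - 1) / 2)) ^+ 2).
      congr Num.sqrt; rewrite exprMn -[(q `^ _) ^+ 2](powR_mulrn 2) ?powR_ge0 // -powRrM.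
      have -> : (d%:R - 1) / 2 * 2%:R = d.+1%:R - 2%:R :> R by rewrite -natr1; field.
      by rewrite powqD powRN !powR_mulrn ?ltW // natrM natrX; ring.
    by rewrite sqrtr_sqr ger0_norm // mulr_ge0 ?powR_ge0.
  rewrite -mulrA ler_wpM2l // /M mulrA ler_pdivlMr //.
  apply: le_trans (ler_wpM2l (ltW (powq0 _)) N_ge); rewrite -{2}(powRr1 (ltW q_gt0)) -!powqD.
  rewrite le_eqVlt; apply/orP; left; apply/eqP; congr (_ `^ _); field.
  by rewrite gt_eqF.
pose eps := lam / M.
have eps_le : eps <= 2 * U by rewrite ler_pdivrMr.
have eps0 : 0 <= eps by rewrite divr_ge0 ?sqrtr_ge0 // ltW.
have lamE : lam = eps * M by rewrite divfK // gt_eqF.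
have NE : N = q * M by rewrite /M mulrC divfK.
have T_le1 : T <= 1.
  rewrite -(powRr0 q); apply: ler_powR; first exact: ltW.
  by rewrite oppr_le0 divr_ge0 // mulr_ge0 // ltW.
have UE : U = T / q `^ (1 / m%:R - (m%:R - 1) * delta / 2).
  by rewrite -powRN -powqD; congr (_ `^ _); field; rewrite gt_eqF.
have eps_T : (2 * m.+1)%:R * 2 ^+ m.+1 * eps <= T.
  apply: le_trans (_ : (2 * m.+1)%:R * 2 ^+ m.+1 * (2 * U) <= _).
    by rewrite ler_wpM2l // mulr_ge0 ?exprn_ge0 ?ler0n.
  have -> : (2 * m.+1)%:R * 2 ^+ m.+1 * (2 * U) = ((4 * m.+1)%:R * 2 ^+ m.+1) * U.
    by rewrite !natrM; ring.
  by rewrite UE mulrA ler_pdivrMr // [leLHS]mulrC ler_wpM2l // powR_ge0.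
rewrite lamE NE.
apply: error_terms_le => //; try exact: ltW.
  apply: le_trans T_le1; apply: le_trans eps_T; rewrite ler_peMl //.
  by rewrite -natrX -natrM ler1n muln_gt0 expn_gt0.
have U_m : U ^+ m * q = T.
  rewrite -powR_mulrn ?powR_ge0 // -powRrM -{2}(powRr1 (ltW q_gt0)) -powqD.
  by congr (_ `^ _); field; rewrite gt_eqF.
rewrite -U_m mulrA -exprMn (ler_wpM2r (ltW q_gt0)) //.
by rewrite lerXn2r ?nnegrE // (le_trans eps0).
Qed.

(** With [j = k - 2] the left side is [24 * 4^j + 1], below [36 + 80 * 6^j]. *)
Lemma main_constant_ge (R : realDomainType) (k : nat) :
  (2 <= k)%N -> 3 * 2 ^+ (2 * k - 1) + 1 <= 36 + 80 * 6 ^+ (k - 2) + 12 * k%:R :> R.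
Proof.
move=> k_ge2; have -> : (2 * k - 1 = 3 + 2 * (k - 2))%N by lia.
rewrite exprD exprM; have -> : 2 ^+ 2 = 4 :> R by rewrite -natrX.
have -> : 2 ^+ 3 = 8 :> R by rewrite -natrX.
have le46 : 4 ^+ (k - 2) <= 6 ^+ (k - 2) :> R by rewrite lerXn2r ?nnegrE // ler_nat.
have pos6 : 0 <= 6 ^+ (k - 2) :> R by rewrite exprn_ge0.
have := ler0n R k; lra.
Qed.

Theorem theorem1p2 (R : realType) (d n k : nat) (delta : R)
    (d_ge2 : (2 <= d)%N) (n_ge5 : (5 <= n)%N)
    (n_eq : n = (2 * k)%N \/ n = (2 * k + 1)%N)
    (delta_gt0 : 0 < delta)
    (delta_lt : delta < 1 / (2 * (n %/ 2)%:R ^+ 2)) :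
  exists q0 : nat, forall F : finFieldType,
    odd #|F| -> (q0 <= #|F|)%N ->
    forall (t : F) (E : {set 'rV[F]_d}),
    t != 0 ->
    let q : R := #|F|%:R in
    (n = (2 * k)%N ->
      q `^ (1 / 2 * (d%:R + 2 - (k%:R - 2) / (k%:R - 1) + delta))
        <= #|E|%:R) ->
    (n = (2 * k + 1)%N ->
      q `^ (1 / 2 * (d%:R + 2 - (2 * k%:R - 3) / (2 * k%:R - 1) + delta))
        <= #|E|%:R) ->
    `| (cycle_count t E n)%:R - #|E|%:R ^+ n / q ^+ n |
      <= (36 + 80 * 6 ^+ (n %/ 2 - 2) + 12 * (n %/ 2)%:R)
         * (#|E|%:R ^+ n / q ^+ n) * q `^ (- ((n%:R / 2 - 1) * delta)).
Proof.
have k_ge2 : (2 <= k)%N by case: n_eq; lia.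
have nk : (n %/ 2 = k)%N by case: n_eq; lia.
rewrite nk in delta_lt *.
have [m nE] : exists m, n = m.+2 by exists (n - 2)%N; lia.
have m_ge3 : (3 <= m)%N by lia.
have m_le : (m <= 2 * k - 1)%N by case: n_eq; lia.
have m0 : 0 < m%:R :> R by rewrite ltr0n; lia.
have k0 : 0 < k%:R :> R by rewrite ltr0n; lia.
(* The bound on [delta] makes [g] positive: [m <= 2 k] gives
   [m (m - 1) delta / 2 <= 2 k^2 delta < 1]. *)
pose g : R := 1 / m%:R - (m%:R - 1) * delta / 2.
have g_gt0 : 0 < g.
  rewrite subr_gt0 ltr_pdivlMr //.
  have mm_le : (m%:R - 1) * m%:R <= (2 * k%:R) ^+ 2 :> R.
    have mk : m%:R <= 2 * k%:R :> R by rewrite -natrM ler_nat; lia.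
    have m1 : 1 <= m%:R :> R by rewrite ler1n ltnW // ltnW.
    nra.
  rewrite ltr_pdivlMr ?mulr_gt0 ?exprn_gt0 // in delta_lt.
  have := ler_wpM2r (ltW delta_gt0) mm_le; nra.
pose B : R := (4 * m.+1)%:R * 2 ^+ m.+1.
(* Chosen so that every admissible [q] satisfies [q^g >= B]. *)
exists (Num.bound (B `^ g^-1)) => F oddF q_big t E t0 q N_even N_odd.
(* In their respective parities, [2 - (k-2)/(k-1)] and [2 - (2k-3)/(2k-1)] both equal [1 + 2/m], so
   one exponent serves both cases. *)
have N_ge : q `^ ((d%:R + 1 + 2 / m%:R + delta) / 2) <= #|E|%:R.
  case: n_eq => nk2; [apply: le_trans (N_even nk2)|apply: le_trans (N_odd nk2)];
    rewrite le_eqVlt; apply/orP; left; apply/eqP; congr (_ `^ _).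
    have mE : m%:R + 2%:R = 2%:R * k%:R :> R.
      by rewrite -natrD -natrM (_ : (m + 2 = 2 * k)%N) //; clear -nE nk2; lia.
    have k1 : k%:R - 1 != 0 :> R by rewrite subr_eq0 (eqr_nat _ k 1); apply/eqP; clear -k_ge2; lia.
    have -> : m%:R = 2 * (k%:R - 1) :> R by lra.
    by field.
  have mE : m%:R + 1%:R = 2%:R * k%:R :> R.
    by rewrite -natrD -natrM (_ : (m + 1 = 2 * k)%N) //; clear -nE nk2; lia.
  have k1 : 2 * k%:R - 1 != 0 :> R by rewrite -mE addrK gt_eqF.
  have -> : m%:R = 2 * k%:R - 1 :> R by lra.
  by field.
have B_le : B <= q `^ g.
  have B0 : 0 <= B by rewrite mulr_ge0 ?exprn_ge0.
  have Bg : B `^ g^-1 <= q.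
    apply: le_trans (ltW (archi_boundP (powR_ge0 _ _))) _; by rewrite ler_nat.
  have := ge0_ler_powR (ltW g_gt0) _ _ Bg; rewrite !nnegrE powR_ge0 ler0n => /(_ isT isT).
  by rewrite -powRrM mulVf ?gt_eqF // powRr1.
have := cycle_count_asymp oddF t0 (ltnW (ltnW m_ge3)) (ltW delta_gt0) N_ge B_le.
rewrite -/q nE expr_div_n => /le_trans; apply.
have -> : - ((m.+2%:R / 2 - 1) * delta) = - (m%:R * delta / 2).
  by rewrite -addn2 natrD; field.
rewrite ler_wpM2r ?powR_ge0 // ler_wpM2r ?divr_ge0 ?exprn_ge0 //.
apply: le_trans (main_constant_ge R k_ge2); rewrite lerD2r ler_wpM2l //.
by rewrite ler_eXn2l ?ltr1n.
Qed.
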